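(* Let $r>1$ be an integer and let $w$ be an element of $\{1,\ldots,r\}^{\mathbb Z}$. Then the map $$\Psi: G.\mathcal P(w)\to (X^{\mathcal N}_{\mathcal P}\times Z_w\times\mathbb R^*_+)/\mathcal R,\qquad g.\mathcal P(w)\mapsto [g.(\mathcal P,w,1)],$$ where $[x]$ denotes the $\mathcal R$-class of $x$, extends to a conjugacy map (a homeomorphism commuting with the actions) between $(X^G_{\mathcal P(w)},G)$ and $\big((X^{\mathcal N}_{\mathcal P}\times Z_w\times\mathbb R^*_+)/\mathcal R,\ G\big)$.
   Context: **Tilings and hull.** $\mathbb H=\{x+iy: y>0\}$ is the hyperbolic upper half-plane and $G$ is the group of maps $z\mapsto az+b$, $a>0$, $b\in\mathbb R$, with the left-invariant metric obtained from the identification $g\mapsto g(i)$ of $G$ with $\mathbb H$. $P$ is the hyperbolic polygon with geodesic edges and vertices $i,\ \tfrac12+i,\ 1+i,\ 1+2i,\ 2i$; $R(z)=2z$, $S(z)=z+1$. The uncoloured Penrose tiling is $\mathcal P=\{R^kS^nP : k,n\in\mathbb Z\}$. For $j\in\{1,\dots,r\}$, $P_j$ is $P$ with colour $j$, and $\mathcal P(w)=\{R^q S^n(P_{w_{-q}}): n,q\in\mathbb Z\}$. $G$ acts on (coloured) tilings by $g.T=g(T)$ (colours preserved); $T+t$ is the image of $T$ under $z\mapsto z+t$. For a tiling $T$, $G.T$ has the metric $\delta(T_1,T_2)=\inf A$ if $A\ne\emptyset$ and $1/\sqrt2$ otherwise, where $A$ is the set of $\epsilon\in(0,1/\sqrt2]$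 for which there is $g\in G$ at distance $<\epsilon$ from the identity such that $g.T_1$ and $T_2$ coincide on the ball of radius $1/\epsilon$ centred at $i$. The hull $X^G_T$ is the completion of $(G.T,\delta)$; it is a compact space of tilings with a continuous $G$-action. With $\mathcal N=\{z\mapsto z+t:t\in\mathbb R\}$, $X^{\mathcal N}_{\mathcal P}$ is the closure of $\mathcal N.\mathcal P$ in $X^G_{\mathcal P}$; $T\mapsto R.T$ is a homeomorphism of it. $\sigma$ is the shift $(\sigma w)_n=w_{n+1}$ and $Z_w=\overline{\{\sigma^n(w):n\in\mathbb Z\}}\subset\{1,\dots,r\}^{\mathbb Z}$. **Suspension.** $\mathcal R$ is the homeomorphism of $X^{\mathcal N}_{\mathcal P}\times Z_w\times\mathbb R^*_+$ given by $\mathcal R(\mathcal T,w',t)=(R.\mathcal T,\sigma(w'),t/2)$; the quotient identifies points of the same $\mathcal R$-orbit. The element $g:z\mapsto az+b$ of $G$ acts on $X^{\mathcal N}_{\mathcal P}\times Z_w\times\mathbb R^*_+$ by $g.(\mathcal T,w',t)=(\mathcal T+\tfrac{b}{at},w',at)$; this commutes with $\mathcal R$ and so defines a continuous $G$-action on the quotient. *)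

(* Defs.v *)
From HB Require Import structures.
From mathcomp Require Import all_boot all_order all_algebra generic_quotient.
From mathcomp Require Import all_classical all_reals.
From mathcomp Require Import topology normedtype sequences exp.
From mathcomp Require Import ring lra.
Import Order.TTheory GRing.Theory Num.Theory.
Import numFieldNormedType.Exports.

Set Implicit Arguments.
Unset Strict Implicit.
Unset Printing Implicit Defensive.

Local Open Scope classical_set_scope.
Local Open Scope ring_scope.

Section HyperbolicPlane.
Variable R : realType.
Implicit Types (u v rho : R) (z w : R * R).

(* x + iy is the pair (x, y); this is the set of those with y > 0 *)
Definition halfplane : set (R * R) := [set z | 0 < z.2].

Definition imI : R * R := (0, 1).

Definition arcosh u : R := ln (u + Num.sqrt (u ^+ 2 - 1)).

Definition hcosh z w : R :=
  1 + ((z.1 - w.1) ^+ 2 + (z.2 - w.2) ^+ 2) / (2 * z.2 * w.2).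

Definition hdist z w : R := arcosh (hcosh z w).

Definition hball rho : set (R * R) :=
  [set z | halfplane z /\ hdist imI z < rho].

(* The geodesics of the half-plane are the loci A (x^2 + y^2) + B x + C = 0:
   p, q and z lie on one of them iff [side p q z] vanishes, and [side p q z]
   is positive iff z is on the left of the geodesic oriented from p to q. *)
Definition side p q z : R :=
  let n (t : R * R) := t.1 ^+ 2 + t.2 ^+ 2 in
  (q.1 - p.1) * (n z - n p) - (n q - n p) * (z.1 - p.1).

(* convex polygon with vertices [s], listed counterclockwise *)
Definition hpolygon (s : seq (R * R)) : set (R * R) :=
  [set z | halfplane z /\
           all (fun e => 0 <= side e.1 e.2 z) (zip s (rot 1 s))].

Definition prototile : set (R * R) :=
  hpolygon [:: (0, 1); (1/2, 1); (1, 1); (1, 2); (0, 2)].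

(* the vertical edges lie on x = 0, 1 and the other three on circles *)
Lemma prototileE : prototile = [set z | [/\ 0 < z.2, 0 <= z.1 <= 1,
  17/16 <= (z.1 - 1/4) ^+ 2 + z.2 ^+ 2, 17/16 <= (z.1 - 3/4) ^+ 2 + z.2 ^+ 2
  & (z.1 - 1/2) ^+ 2 + z.2 ^+ 2 <= 17/4]].
Proof.
rewrite /prototile /hpolygon /halfplane /side /=.
apply/seteqP; split=> -[x y] /=; rewrite andbT.
  by move=> [y0 /and5P[h1 h2 h3 h4 h5]]; split=> //; lra.
move=> [y0 /andP[x0 x1] h1 h2 h3]; split => //.
by apply/and5P; split; lra.
Qed.

Lemma arcosh0 : arcosh 1 = 0.
Proof. by rewrite /arcosh expr1n subrr sqrtr0 addr0 ln1. Qed.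

Let E u : R := u + Num.sqrt (u ^+ 2 - 1).

Let E_ge u : 1 <= u -> 1 <= E u.
Proof. by move=> u1; rewrite /E (le_trans u1)// lerDl sqrtr_ge0. Qed.

Let E_pos u : 1 <= u -> E u \is Num.pos.
Proof. by move=> u1; rewrite posrE (lt_le_trans ltr01)// E_ge. Qed.

Lemma arcosh_ge0 u : 1 <= u -> 0 <= arcosh u.
Proof. by move=> u1; rewrite ln_ge0// E_ge. Qed.

Lemma ler_arcosh u v : 1 <= u -> u <= v -> arcosh u <= arcosh v.
Proof.
move=> u1 uv; have v1 := le_trans u1 uv.
rewrite /arcosh ler_ln ?E_pos// lerD//.
by rewrite ler_wsqrtr// lerB// lerXn2r// nnegrE; lra.
Qed.

Lemma arcoshD a b : 1 <= a -> 1 <= b ->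
  arcosh (a * b + Num.sqrt (a ^+ 2 - 1) * Num.sqrt (b ^+ 2 - 1)) =
  arcosh a + arcosh b.
Proof.
move=> a1 b1; rewrite /arcosh -lnM ?E_pos//.
set x := Num.sqrt _; set y := Num.sqrt (b ^+ 2 - 1).
have x0 : 0 <= x := sqrtr_ge0 _; have y0 : 0 <= y := sqrtr_ge0 _.
have xE : x ^+ 2 = a ^+ 2 - 1 by rewrite sqr_sqrtr//; nra.
have yE : y ^+ 2 = b ^+ 2 - 1 by rewrite sqr_sqrtr//; nra.
have -> : (a * b + x * y) ^+ 2 - 1 = (a * y + b * x) ^+ 2.
  have -> : (a * b + x * y) ^+ 2 - 1 =
    a ^+ 2 * b ^+ 2 + 2 * a * b * x * y + x ^+ 2 * y ^+ 2 - 1 by ring.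
  have -> : (a * y + b * x) ^+ 2 =
    a ^+ 2 * y ^+ 2 + 2 * a * b * x * y + x ^+ 2 * b ^+ 2 by ring.
  rewrite xE yE; ring.
rewrite sqrtr_sqr ger0_norm; last by rewrite addr_ge0// mulr_ge0//; lra.
congr ln; ring.
Qed.

Lemma arcosh_small (K e : R) : 0 <= K -> 0 < e -> exists2 f, 0 < f &
  forall u, 1 <= u -> arcosh u < f -> arcosh (1 + K * (u - 1)) < e.
Proof.
move=> K0 e0.
(* v0 <= 1 and K v0 + sqrt (2 K v0 + (K v0)^2) < e *)
pose m := Num.min 1 (e / 3).
have m0 : 0 < m by rewrite lt_min ltr01 divr_gt0.
have m1 : m <= 1 by rewrite ge_min lexx.
have m2 : m <= e / 3 by rewrite ge_min lexx orbT.
pose v := m ^+ 2 / (2 * (K + 1)).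
have K1 : 0 < 2 * (K + 1) by lra.
have v0 : 0 < v by rewrite divr_gt0// exprn_gt0.
have Kv : 2 * (K * v) <= m ^+ 2.
  have : v * (2 * (K + 1)) = m ^+ 2 by rewrite /v mulfVK// gt_eqF.
  nra.
exists (ln (1 + v)).
  by rewrite -ln1 ltr_ln ?posrE//; lra.
move=> u u1; rewrite /arcosh ltr_ln ?E_pos ?posrE//; last by lra.
move=> uv; have uv' : u - 1 < v.
  by have := sqrtr_ge0 (u ^+ 2 - 1); lra.
set t := K * (u - 1).
have t0 : 0 <= t by rewrite mulr_ge0//; lra.
have t2 : 2 * t <= m ^+ 2 by apply: le_trans Kv; rewrite ler_pM2l// ler_wpM2l// ltW.
rewrite -addrA; apply: le_lt_trans (le_ln1Dx _) _.
  by have := sqrtr_ge0 ((1 + t) ^+ 2 - 1); lra.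
have mm : m ^+ 2 <= m by nra.
have : Num.sqrt ((1 + t) ^+ 2 - 1) <= 3/2 * m.
  rewrite -(@ger0_norm _ (3/2 * m)); last by lra.
  have t1 : t <= m by lra.
  by rewrite -sqrtr_sqr ler_wsqrtr//; nra.
by have : t <= m / 2 by [lra]; lra.
Qed.

Lemma hcosh_ge1 z w : halfplane z -> halfplane w -> 1 <= hcosh z w.
Proof.
move=> z0 w0; rewrite lerDl divr_ge0 ?addr_ge0 ?sqr_ge0//.
by rewrite !mulr_ge0// ltW.
Qed.

Lemma hdist_ge0 z w : halfplane z -> halfplane w -> 0 <= hdist z w.
Proof. by move=> z0 w0; rewrite arcosh_ge0 ?hcosh_ge1. Qed.

Lemma hdistC z w : hdist z w = hdist w z.
Proof.
rewrite /hdist /hcosh -(sqrrN (z.1 - w.1)) -(sqrrN (z.2 - w.2)) !opprB.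
by rewrite mulrAC.
Qed.

Lemma hdist_tri0 z w : halfplane z -> halfplane w ->
  hdist z w <= hdist z imI + hdist imI w.
Proof.
move=> z0 w0; have i0 : halfplane imI by exact: ltr01.
rewrite /hdist -arcoshD ?hcosh_ge1//; apply: ler_arcosh.
  exact: hcosh_ge1.
set a := hcosh z imI; set b := hcosh imI w; set c := hcosh z w.
have a1 : 1 <= a by apply: hcosh_ge1.
have b1 : 1 <= b by apply: hcosh_ge1.
rewrite -sqrtrM; last by nra.
rewrite -lerBlDl; apply: le_trans (ler_norm _) _.
rewrite -sqrtr_sqr ler_wsqrtr// -subr_ge0.
case: z w @a @b @c {z0 w0 i0 a1 b1} (z0 : 0 < z.2) (w0 : 0 < w.2) => x y [x' y'].
rewrite /hcosh /= => y0 y0'.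
set l := (X in 0 <= X).
suff -> : l = ((x * (x'^+2 + y'^+2 - 1) - x' * (x^+2 + y^+2 - 1))
   / (2 * y * y')) ^+ 2 by exact: sqr_ge0.
by rewrite /l; field; rewrite !gt_eqF.
Qed.

End HyperbolicPlane.

Arguments prototile R : clear implicits.

Section AffineGroup.
Variable R : realType.

(* z |-> scale z + trans *)
Record aff := Aff { scale : R; trans : R; scale_gt0 : 0 < scale }.

Lemma aff_eq (g h : aff) : scale g = scale h -> trans g = trans h -> g = h.
Proof.
case: g h => a b a0 [a' b' a0'] /= aa' bb'; case: _ / aa' in a0' *.
by case: _ / bb'; congr Aff; exact: eq_irrelevance.
Qed.

Definition aff1 : aff := @Aff 1 0 ltr01.

Definition aff_mul (g h : aff) : aff :=
  Aff (scale g * trans h + trans g) (mulr_gt0 (scale_gt0 g) (scale_gt0 h)).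

Definition aff_inv (g : aff) : aff :=
  @Aff (scale g)^-1 (- trans g / scale g)
    (etrans (invr_gt0 (scale g)) (scale_gt0 g)).

Definition translation (t : R) : aff := @Aff 1 t ltr01.
Definition dilation (a : R) (a0 : 0 < a) : aff := @Aff a 0 a0.

(* R(z) = 2 z *)
Definition affR : aff := dilation (ltr0Sn R 1).

Lemma aff_mulVg g : aff_mul (aff_inv g) g = aff1.
Proof.
have g0 := lt0r_neq0 (scale_gt0 g).
by apply: aff_eq => /=; field.
Qed.

Lemma aff_mulgV g : aff_mul g (aff_inv g) = aff1.
Proof.
have g0 := lt0r_neq0 (scale_gt0 g).
by apply: aff_eq => /=; field.
Qed.

Lemma aff_mulA g h k : aff_mul g (aff_mul h k) = aff_mul (aff_mul g h) k.
Proof. by apply: aff_eq => /=; ring. Qed.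

Lemma aff_mul1g g : aff_mul aff1 g = g.
Proof. by apply: aff_eq => /=; ring. Qed.

Lemma aff_mulg1 g : aff_mul g aff1 = g.
Proof. by apply: aff_eq => /=; ring. Qed.

Definition aff_pt (g : aff) (z : R * R) : R * R :=
  (scale g * z.1 + trans g, scale g * z.2).

Lemma aff_ptM g h z : aff_pt (aff_mul g h) z = aff_pt g (aff_pt h z).
Proof. by congr pair => /=; ring. Qed.

Lemma aff_pt1 z : aff_pt aff1 z = z.
Proof. by case: z => x y; congr pair => /=; ring. Qed.

Lemma aff_ptK g : cancel (aff_pt g) (aff_pt (aff_inv g)).
Proof. by move=> z; rewrite -aff_ptM aff_mulVg aff_pt1. Qed.

Lemma aff_ptVK g : cancel (aff_pt (aff_inv g)) (aff_pt g).
Proof. by move=> z; rewrite -aff_ptM aff_mulgV aff_pt1. Qed.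

Lemma halfplane_aff g z : halfplane (aff_pt g z) <-> halfplane z.
Proof. by rewrite /halfplane/= pmulr_rgt0// scale_gt0. Qed.

Lemma hdist_aff g z w : hdist (aff_pt g z) (aff_pt g w) = hdist z w.
Proof.
have g0 := lt0r_neq0 (scale_gt0 g).
rewrite /hdist /hcosh /=; congr (arcosh (1 + _)).
have -> : (scale g * z.1 + trans g - (scale g * w.1 + trans g)) ^+ 2 +
  (scale g * z.2 - scale g * w.2) ^+ 2 =
  scale g ^+ 2 * ((z.1 - w.1) ^+ 2 + (z.2 - w.2) ^+ 2) by ring.
have -> : 2 * (scale g * z.2) * (scale g * w.2) =
  scale g ^+ 2 * (2 * z.2 * w.2) by ring.
by rewrite -mulf_div divff ?mul1r// expf_neq0.
Qed.

Lemma hdist_tri (z v w : R * R) : halfplane z -> halfplane v -> halfplane w ->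
  hdist z w <= hdist z v + hdist v w.
Proof.
move=> z0 v0 w0.
pose g := @Aff v.2 v.1 v0.
have -> : v = aff_pt g (imI R).
  by rewrite [LHS]surjective_pairing; congr pair => /=; ring.
rewrite -(aff_ptVK g z) -(aff_ptVK g w) !(hdist_aff g).
by apply: hdist_tri0; apply/(halfplane_aff g); rewrite aff_ptVK.
Qed.

(* distance from g to the identity, for the metric transported from the
   half-plane by g |-> g(i) *)
Definition aff_norm (g : aff) : R := hdist (imI R) (aff_pt g (imI R)).

Lemma halfplane_imI : halfplane (imI R). Proof. exact: ltr01. Qed.
Hint Resolve halfplane_imI : core.

Lemma aff_norm_ge0 g : 0 <= aff_norm g.
Proof. by apply: hdist_ge0 => //; apply/halfplane_aff. Qed.

Lemma aff_norm1 : aff_norm aff1 = 0.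
Proof.
by rewrite /aff_norm aff_pt1 /hdist /hcosh /= !subrr expr0n /= !addr0 mul0r
  addr0 arcosh0.
Qed.

Lemma aff_normM g h : aff_norm (aff_mul g h) <= aff_norm g + aff_norm h.
Proof.
rewrite /aff_norm aff_ptM.
apply: le_trans (@hdist_tri _ (aff_pt g (imI R)) _ _ _ _) _ => //.
- exact/halfplane_aff.
- by do 2 apply/halfplane_aff.
- by rewrite hdist_aff.
Qed.

Lemma aff_normV g : aff_norm (aff_inv g) = aff_norm g.
Proof. by rewrite /aff_norm -(hdist_aff g) aff_ptVK hdistC. Qed.

Lemma aff_norm_conj g e : 0 < e -> exists2 f, 0 < f &
  forall h, aff_norm h < f -> aff_norm (aff_mul g (aff_mul h (aff_inv g))) < e.
Proof.
move=> e0; set a := scale g; set b := trans g.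
pose K := 2 * a ^+ 2 + 2 * b ^+ 2 + 1.
have K0 : 0 <= K by rewrite /K; nra.
have [f f0 fP] := arcosh_small K0 e0.
exists f => // h; rewrite /aff_norm /hdist => hf.
have h1 : 1 <= hcosh (imI R) (aff_pt h (imI R)).
  by apply: hcosh_ge1 => //; apply/halfplane_aff.
apply: le_lt_trans (fP _ h1 hf).
apply: ler_arcosh.
  by apply: hcosh_ge1 => //; apply/halfplane_aff.
rewrite /hcosh lerD2l addrAC subrr add0r /=.
rewrite !mulr0 !add0r !mulr1 -/a -/b.
have a0 : 0 < a := scale_gt0 g.
set s := scale h; set t := trans h.
have s0 : 0 < s := scale_gt0 h.
have -> : a * (s / a) = s by field; rewrite gt_eqF.
have -> : a * (s * (- b / a) + t) + b = a * t + b * (1 - s).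
  by field; rewrite gt_eqF.
rewrite !sqrrN mulrA ler_pM2r ?invr_gt0 ?mulr_gt0//.
have := sqr_ge0 (a * t - b * (1 - s)); rewrite /K.
have := mulr_ge0 (sqr_ge0 a) (sqr_ge0 (1 - s)).
have := mulr_ge0 (sqr_ge0 b) (sqr_ge0 t).
have := sqr_ge0 t.
nra.
Qed.

Lemma hball_aff g rho sig z : aff_norm g + sig <= rho ->
  hball sig z -> hball rho (aff_pt g z).
Proof.
move=> le [z0 zs]; split; first exact/halfplane_aff.
apply: le_lt_trans (@hdist_tri _ (aff_pt g (imI R)) _ _ _ _) _ => //.
- exact/halfplane_aff.
- exact/halfplane_aff.
- by rewrite hdist_aff -/(aff_norm g) (lt_le_trans _ le)// ltrD2l.
Qed.

End AffineGroup.

Section Tilings.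
Variables (R : realType) (C : Type).
Implicit Types e f rho sig : R.

Definition tile : Type := (set (R * R) * C)%type.
Definition tiling : Type := set tile.

Definition tile_act (g : aff R) (p : tile) : tile := (aff_pt g @` p.1, p.2).
Definition tiling_act (g : aff R) (T : tiling) : tiling := tile_act g @` T.

Definition tiles_meeting (B : set (R * R)) (T : tiling) : tiling :=
  [set p | T p /\ p.1 `&` B !=set0].

Definition coincide (B : set (R * R)) (T1 T2 : tiling) : Prop :=
  tiles_meeting B T1 = tiles_meeting B T2.

Definition agree (e : R) (T1 T2 : tiling) : Prop := exists g : aff R,
  aff_norm g < e /\ coincide (hball e^-1) (tiling_act g T1) T2.

Definition delta (T1 T2 : tiling) : R :=
  let A := [set e | 0 < e <= (Num.sqrt 2)^-1 /\ agree e T1 T2] in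
  if `[< A !=set0 >] then inf A else (Num.sqrt 2)^-1.

Lemma coincideP B T1 T2 : coincide B T1 T2 <->
  forall p : tile, p.1 `&` B !=set0 -> (T1 p <-> T2 p).
Proof.
split=> [/seteqP[T12 T21] p pB|T12].
  by split=> Tp; [have [] := T12 p (conj Tp pB)|have [] := T21 p (conj Tp pB)].
by apply/seteqP; split=> p [Tp pB]; split=> //; apply/(T12 p pB).
Qed.

Lemma tile_actM g h p : tile_act (aff_mul g h) p = tile_act g (tile_act h p).
Proof.
rewrite /tile_act /= image_comp; congr (_ @` _, _).
by apply/funext => z; rewrite aff_ptM.
Qed.

Lemma tile_act1 p : tile_act (aff1 R) p = p.
Proof.
case: p => p c; congr pair; rewrite -[RHS]image_id; congr (_ @` _).
by apply/funext => z; rewrite aff_pt1.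
Qed.

Lemma tiling_actE g T p : tiling_act g T p <-> T (tile_act (aff_inv g) p).
Proof.
split=> [[q Tq <-]|Tp]; first by rewrite -tile_actM aff_mulVg tile_act1.
by exists (tile_act (aff_inv g) p) => //; rewrite -tile_actM aff_mulgV tile_act1.
Qed.

Lemma tiling_actM g h T :
  tiling_act (aff_mul g h) T = tiling_act g (tiling_act h T).
Proof.
rewrite /tiling_act image_comp; congr (_ @` _).
by apply/funext => p; rewrite /= tile_actM.
Qed.

Lemma tiling_act1 T : tiling_act (aff1 R) T = T.
Proof.
rewrite -[RHS]image_id; congr (_ @` _).
by apply/funext => p; rewrite tile_act1.
Qed.

Lemma coincide_act g rho sig T1 T2 : aff_norm g + sig <= rho ->
  coincide (hball rho) T1 T2 ->
  coincide (hball sig) (tiling_act g T1) (tiling_act g T2).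
Proof.
move=> le /coincideP T12; apply/coincideP => p [z [pz zs]].
rewrite !tiling_actE; apply: T12.
exists (aff_pt (aff_inv g) z); split; first by exists z.
by apply: hball_aff zs; rewrite aff_normV.
Qed.

Lemma coincide_le rho sig T1 T2 : sig <= rho ->
  coincide (hball rho) T1 T2 -> coincide (hball sig) T1 T2.
Proof.
move=> le /coincideP T12; apply/coincideP => p [z [pz [z0 zs]]].
apply: T12; exists z; split => //; split => //.
exact: lt_le_trans le.
Qed.

Lemma agree_refl e T : 0 < e -> agree e T T.
Proof. by move=> e0; exists (aff1 R); rewrite aff_norm1 tiling_act1. Qed.

Lemma agree_le e f T1 T2 : 0 < e -> e <= f -> agree e T1 T2 -> agree f T1 T2.
Proof.
move=> e0 ef [g [ge T12]]; exists g; split; first exact: lt_le_trans ef.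
by apply: coincide_le T12; rewrite lef_pV2// posrE// (lt_le_trans e0).
Qed.

Lemma agree_trans e f T1 T2 T3 : 0 < e -> 0 < f -> e + f <= (Num.sqrt 2)^-1 ->
  agree e T1 T2 -> agree f T2 T3 -> agree (e + f) T1 T3.
Proof.
move=> e0 f0 ef [g [ge T12]] [h [hf T23]].
exists (aff_mul h g); split.
  by rewrite addrC (le_lt_trans (aff_normM _ _))// ltrD.
have ef2 : (e + f) ^+ 2 <= 2^-1.
  rewrite -[2 in leRHS](@sqr_sqrtr R)// -exprVn lerXn2r// nnegrE ?invr_ge0 ?sqrtr_ge0//.
  by rewrite addr_ge0// ltW.
have efV : 0 < (e + f)^-1 by rewrite invr_gt0 addr_gt0.
have {}T23 : coincide (hball (e + f)^-1) (tiling_act h T2) T3.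
  by apply: coincide_le T23; rewrite lef_pV2 ?posrE ?addr_gt0// lerDr ltW.
rewrite /coincide -T23.
rewrite tiling_actM; apply: coincide_act T12.
apply: le_trans (_ : f + (e + f)^-1 <= _); first by rewrite lerD2r ltW.
rewrite -(ler_pM2r (mulr_gt0 e0 (addr_gt0 e0 f0))).
have -> : e^-1 * (e * (e + f)) = e + f by field; rewrite gt_eqF.
have -> : (f + (e + f)^-1) * (e * (e + f)) = f * (e * (e + f)) + e.
  by field; rewrite gt_eqF// addr_gt0.
by rewrite addrC lerD2l ger_pMr//; nra.
Qed.

Lemma agree_sym e T1 T2 : 0 < e <= (Num.sqrt 2)^-1 -> agree e T1 T2 ->
  agree (2 * e) T2 T1.
Proof.
move=> /andP[e0 e1] [g [ge T12]]; exists (aff_inv g); rewrite aff_normV; split.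
  by lra.
have e2 : e ^+ 2 <= 2^-1.
  rewrite -[2 in leRHS](@sqr_sqrtr R)// -exprVn lerXn2r// nnegrE ?invr_ge0 ?sqrtr_ge0//.
  exact: ltW.
rewrite -[X in coincide _ _ X](tiling_act1 T1) -(aff_mulVg g) tiling_actM.
apply: coincide_act (esym T12); rewrite aff_normV.
apply: le_trans (_ : e + (2 * e)^-1 <= _); first by rewrite lerD2r ltW.
rewrite -(ler_pM2r (mulr_gt0 (ltr0Sn R 1) e0)).
have -> : e^-1 * (2 * e) = 2 by field; rewrite gt_eqF.
have -> : (e + (2 * e)^-1) * (2 * e) = 2 * e ^+ 2 + 1 by field; rewrite gt_eqF.
lra.
Qed.

Lemma agree_act g e : 0 < e -> exists2 f, 0 < f & forall T1 T2,
  agree f T1 T2 -> agree e (tiling_act g T1) (tiling_act g T2).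
Proof.
move=> e0; have [f f0 fP] := aff_norm_conj g e0.
pose k := (aff_norm g + e^-1)^-1.
have k0 : 0 < k.
  by rewrite invr_gt0 ltr_wpDl ?aff_norm_ge0// invr_gt0.
pose m := Num.min f k.
have m0 : 0 < m by rewrite lt_min f0.
exists m => // T1 T2 [h [hm T12]].
exists (aff_mul g (aff_mul h (aff_inv g))); split.
  by apply: fP; rewrite (lt_le_trans hm)// ge_min lexx.
rewrite -tiling_actM -2!aff_mulA aff_mulVg aff_mulg1 tiling_actM.
apply: coincide_act T12.
by rewrite -[leLHS]invrK lef_pV2 ?posrE// ge_min lexx orbT.
Qed.

Let q2 : R := (Num.sqrt 2)^-1.

Let q2_gt0 : 0 < q2. Proof. by rewrite invr_gt0 sqrtr_gt0. Qed.

Lemma delta_le T1 T2 : delta T1 T2 <= q2.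
Proof.
rewrite /delta; case: asboolP => // -[e [/andP[e0 e1] Te]].
apply: (le_trans _ e1); apply: ge_inf; last by rewrite /= e0 e1.
by exists 0 => x [/andP[/ltW]].
Qed.

Lemma delta_ge0 T1 T2 : 0 <= delta T1 T2.
Proof.
rewrite /delta; case: asboolP => [A0|_]; last exact: ltW.
by apply: lb_le_inf => // x [/andP[/ltW]].
Qed.

Lemma agree_delta e T1 T2 : 0 < e -> agree e T1 T2 -> delta T1 T2 <= e.
Proof.
move=> e0 Te; have [eq2|/ltW] := leP e q2; last exact/le_trans/delta_le.
rewrite /delta asboolT; last by exists e; rewrite /= e0.
by apply: ge_inf; [exists 0 => x [/andP[/ltW]]|rewrite /= e0].
Qed.

Lemma delta_agree e T1 T2 : e <= q2 -> delta T1 T2 < e -> agree e T1 T2.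
Proof.
move=> eq2; rewrite /delta; case: asboolP => [A0 /inf_lt|_]; last first.
  by rewrite ltNge eq2.
case=> // f [/andP[f0 _] Tf] /ltW fe; exact: agree_le Tf.
Qed.

Lemma delta_xx T : delta T T = 0.
Proof.
apply/eqP; rewrite eq_le delta_ge0 andbT; apply/ler_addgt0Pr => e e0.
by rewrite add0r agree_delta//; exact: agree_refl.
Qed.

Lemma delta_tri T2 T1 T3 : delta T1 T3 <= delta T1 T2 + delta T2 T3.
Proof.
apply/ler_addgt0Pr => e e0.
set a := delta T1 T2; set b := delta T2 T3.
have [abq|/ltW] := leP (a + b + e) q2; last exact/le_trans/delta_le.
have a0 : 0 <= a := delta_ge0 _ _; have b0 : 0 <= b := delta_ge0 _ _.
have -> : a + b + e = (a + e / 2) + (b + e / 2) by field.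
apply: agree_delta; first by lra.
apply: (@agree_trans _ _ _ T2); [lra|lra|rewrite -/q2; lra| |].
- by apply: delta_agree; rewrite -/a; lra.
- by apply: delta_agree; rewrite -/b; lra.
Qed.

(* delta is not exactly symmetric, because the balls are centred at i
   and not at g(i) *)
Lemma delta_sym e : 0 < e -> exists2 f, 0 < f & forall T1 T2,
  delta T1 T2 < f -> delta T2 T1 < e.
Proof.
move=> e0; exists (Num.min q2 (e / 3)); first by rewrite lt_min q2_gt0 divr_gt0.
set f := Num.min _ _ => T1 T2 Tf.
have f1 : f <= q2 by rewrite ge_min lexx.
have f2 : f <= e / 3 by rewrite ge_min lexx orbT.
have f0 : 0 < f by rewrite lt_min q2_gt0 divr_gt0.
have : agree (2 * f) T2 T1 by apply: agree_sym; rewrite ?f0//; exact: delta_agree.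
by move=> /agree_delta; rewrite mulr_gt0// => /(_ isT); lra.
Qed.

Lemma delta_act g e : 0 < e -> exists2 f, 0 < f & forall T1 T2,
  delta T1 T2 < f -> delta (tiling_act g T1) (tiling_act g T2) < e.
Proof.
move=> e0; have e20 : 0 < e / 2 by rewrite divr_gt0.
have [f f0 fP] := agree_act g e20.
exists (Num.min q2 f); first by rewrite lt_min q2_gt0.
move=> T1 T2 Tf; apply: le_lt_trans (_ : e / 2 < e); last by lra.
apply: agree_delta => //; apply: fP.
apply: (agree_le _ _ (delta_agree _ Tf)); rewrite ?ge_min ?lexx ?orbT//.
by rewrite lt_min q2_gt0.
Qed.

End Tilings.

Definition set_elt (T : Type) (A : set T) (x : T) (Ax : x \in A) : A :=
  exist _ x Ax.

(* [qdist] is a metric, except that symmetry only holds up to uniform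
   equivalence and that points at distance 0 may differ (the completion
   identifies them) *)
Record quasimetric (R : realType) := Quasimetric {
  qm_sort :> Type;
  qdist : qm_sort -> qm_sort -> R;
  qdistxx : forall x, qdist x x = 0;
  qdist_ge0 : forall x y, 0 <= qdist x y;
  qdist_tri : forall y x z, qdist x z <= qdist x y + qdist y z;
  qdist_sym : forall e, 0 < e -> exists2 f, 0 < f &
    forall x y, qdist x y < f -> qdist y x < e }.

Definition is_cauchy (R : realType) (X : quasimetric R) (u : nat -> X) : Prop :=
  forall e : R, 0 < e -> exists N, forall m n, (N <= m)%N -> (N <= n)%N ->
    qdist (u m) (u n) < e.

Record cauchy_sequence (R : realType) (X : quasimetric R) := CauchySequence {
  cseq :> nat -> X;
  cseqP : is_cauchy cseq }.

HB.instance Definition _ R X := gen_eqMixin (@cauchy_sequence R X).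
HB.instance Definition _ R X := gen_choiceMixin (@cauchy_sequence R X).

Section CauchyEquivalence.
Variables (R : realType) (X : quasimetric R).
Implicit Types u v w : cauchy_sequence X.

Definition cauchy_equiv u v : bool :=
  `[< (fun n => qdist (u n) (v n)) @ \oo --> (0 : R) >].

Lemma cauchy_equivP u v : reflect
  (forall e, 0 < e -> \forall n \near \oo, qdist (u n) (v n) < e)
  (cauchy_equiv u v).
Proof.
apply: (iffP idP) => [/asboolP uv e e0|uv].
  by apply: cvgr_lt e0.
apply/asboolP/cvgrPdist_lt => e e0; near=> n.
by rewrite sub0r normrN ger0_norm ?qdist_ge0//; near: n; exact: uv.
Unshelve. all: by end_near. Qed.

Lemma cauchy_equiv_refl : reflexive cauchy_equiv.
Proof. by move=> u; apply/cauchy_equivP => e e0; near=> n; rewrite qdistxx.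
Unshelve. all: by end_near. Qed.

Lemma cauchy_equiv_sym : symmetric cauchy_equiv.
Proof.
suff H u v : cauchy_equiv u v -> cauchy_equiv v u.
  by move=> u v; apply/idP/idP => /H.
move=> /cauchy_equivP uv; apply/cauchy_equivP => e e0.
have [f f0 fP] := qdist_sym X e0.
by near=> n; apply: fP; near: n; exact: uv.
Unshelve. all: by end_near. Qed.

Lemma cauchy_equiv_trans : transitive cauchy_equiv.
Proof.
move=> v u w /cauchy_equivP uv /cauchy_equivP vw; apply/cauchy_equivP => e e0.
have e2 : 0 < e / 2 by rewrite divr_gt0.
near=> n; apply: le_lt_trans (qdist_tri (v n) _ _) _.
by rewrite [ltRHS]splitr ltrD//; near: n; [exact: uv|exact: vw].
Unshelve. all: by end_near. Qed.

Canonical cauchy_equivalence := EquivRel cauchy_equiv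
  cauchy_equiv_refl cauchy_equiv_sym cauchy_equiv_trans.

End CauchyEquivalence.

Definition completion (R : realType) (X : quasimetric R) : Type :=
  {eq_quot @cauchy_equivalence R X}%qT.

HB.instance Definition _ R X := EqQuotient.on (@completion R X).
HB.instance Definition _ R X := Choice.on (@completion R X).

Section Completion.
Variables (R : realType) (X : quasimetric R).
Implicit Types (u v : cauchy_sequence X) (x y : completion X).
Local Open Scope quotient_scope.

Definition cclass u : completion X := \pi_(completion X) u.

Lemma cclassP u v : cclass u = cclass v <-> cauchy_equiv u v.
Proof. by split=> [/eqmodP|uv]; last exact/eqmodP. Qed.

Lemma creprK x : cclass (repr x) = x.
Proof. exact: reprK. Qed.

Definition cdist x y : R := lim ((fun n => qdist (repr x n) (repr y n)) @ \oo).

Definition completion_open (U : set (completion X)) : Prop :=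
  forall x, U x -> exists2 e, 0 < e & forall y, cdist x y < e -> U y.

Let completion_openT : completion_open setT.
Proof. by exists 1. Qed.

Let completion_openI : setI_closed completion_open.
Proof.
move=> U V oU oV x [/oU[e e0 eU] /oV[f f0 fV]].
exists (Num.min e f); first by rewrite lt_min e0.
by move=> y; rewrite lt_min => /andP[/eU ? /fV ?]; split.
Qed.

Let completion_open_bigU (I : Type) (f : I -> set (completion X)) :
  (forall i, completion_open (f i)) -> completion_open (\bigcup_i f i).
Proof.
move=> of_ x [i _ /of_[e e0 ei]]; exists e => // y /ei ?.
by exists i.
Qed.

HB.instance Definition _ := isOpenTopological.Build (completion X)
  completion_openT completion_openI completion_open_bigU.

Lemma completion_openE (U : set (completion X)) :
  open U = completion_open U.
Proof. by []. Qed.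

Lemma qdist_cvg u v : cvg ((fun n => qdist (u n) (v n)) @ \oo).
Proof.
apply/cauchy_cvgP; apply: cauchy_exP => e e0.
have e2 : 0 < e / 2 by rewrite divr_gt0.
have [N uN] := cseqP u e2; have [M vM] := cseqP v e2.
exists (qdist (u (maxn N M)) (v (maxn N M))).
exists (maxn N M) => //= n /=; rewrite geq_max => /andP[Nn Mn].
rewrite /ball /= ltr_norml ltrBlDr ltrBrDl.
set k := maxn N M.
have Nk : (N <= k)%N by rewrite leq_maxl.
have Mk : (M <= k)%N by rewrite leq_maxr.
have := qdist_tri (u n) (u k) (v k); have := qdist_tri (v n) (u n) (v k).
have := qdist_tri (u k) (u n) (v n); have := qdist_tri (v k) (u k) (v n).
have := uN _ _ Nk Nn; have := uN _ _ Nn Nk.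
have := vM _ _ Mk Mn; have := vM _ _ Mn Mk.
by move=> *; apply/andP; split; lra.
Qed.

Lemma cdist_lt x y e : cdist x y < e ->
  \forall n \near \oo, qdist (repr x n) (repr y n) < e.
Proof. by apply: cvgr_lt; exact: qdist_cvg. Qed.

Lemma cdist_le u v e : (\forall n \near \oo, qdist (u n) (v n) <= e) ->
  cdist (cclass u) (cclass v) <= e.
Proof.
move=> uve; apply/ler_addgt0Pr => d d0; apply: limr_le; first exact: qdist_cvg.
have d2 : 0 < d / 2 by rewrite divr_gt0.
have /cclassP/cauchy_equivP/(_ _ d2) uP := creprK (cclass u).
have /esym/cclassP/cauchy_equivP/(_ _ d2) vP := creprK (cclass v).
near=> n.
apply: le_trans (qdist_tri (u n) _ _) _.
have : qdist (u n) (v n) <= e by near: n.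
have : qdist (repr (cclass u) n) (u n) < d / 2 by near: n.
have : qdist (v n) (repr (cclass v) n) < d / 2 by near: n.
have := qdist_tri (v n) (u n) (repr (cclass v) n).
lra.
Unshelve. all: by end_near. Qed.

Lemma const_cauchy (x : X) : is_cauchy (fun _ => x).
Proof. by move=> e e0; exists 0%N => m n _ _; rewrite qdistxx. Qed.

Definition cembed (x : X) : completion X := cclass (CauchySequence (const_cauchy x)).

End Completion.

Definition uniform_map (R : realType) (X Y : quasimetric R) (f : X -> Y) : Prop :=
  forall e : R, 0 < e -> exists2 d, 0 < d &
    forall x y, qdist x y < d -> qdist (f x) (f y) < e.

Section CompletionMap.
Variable R : realType.

Lemma uniform_cauchy (X Y : quasimetric R) (f : X -> Y) (u : cauchy_sequence X) :
  uniform_map f -> is_cauchy (f \o u).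
Proof.
move=> uf e /uf[d d0 df]; have [N uN] := cseqP u d0.
by exists N => m n Nm Nn; apply: df; exact: uN.
Qed.

(* the extension to the completions of a uniformly continuous map *)
Definition cmap (X Y : quasimetric R) (f : X -> Y) (uf : uniform_map f)
  (x : completion X) : completion Y :=
  cclass (CauchySequence (uniform_cauchy (repr x) uf)).

Lemma cmapE (X Y : quasimetric R) (f : X -> Y) (uf : uniform_map f)
  (u : cauchy_sequence X) :
  cmap uf (cclass u) = cclass (CauchySequence (uniform_cauchy u uf)).
Proof.
apply/cclassP/cauchy_equivP => e /uf[d d0 df].
have /cclassP/cauchy_equivP/(_ _ d0) uP := creprK (cclass u).
by near=> n; apply: df; near: n.
Unshelve. all: by end_near. Qed.

Lemma cclass_ext (X : quasimetric R) (u v : cauchy_sequence X) :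
  u =1 v -> cclass u = cclass v.
Proof.
move=> uv; apply/cclassP/cauchy_equivP => e e0.
by near=> n; rewrite uv qdistxx.
Unshelve. all: by end_near. Qed.

Lemma cmap_embed (X Y : quasimetric R) (f : X -> Y) (uf : uniform_map f) x :
  cmap uf (cembed x) = cembed (f x).
Proof. by rewrite cmapE; exact: cclass_ext. Qed.

Lemma cmap_id (X : quasimetric R) (f : X -> X) (uf : uniform_map f) x :
  f =1 id -> cmap uf x = x.
Proof.
by move=> f1; rewrite -[x]creprK cmapE; apply: cclass_ext => n /=.
Qed.

Lemma cmap_comp (X Y Z : quasimetric R) (f : Y -> Z) (g : X -> Y) (h : X -> Z)
  (uf : uniform_map f) (ug : uniform_map g) (uh : uniform_map h) x :
  f \o g =1 h -> cmap uf (cmap ug x) = cmap uh x.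
Proof.
move=> fg; rewrite -[x]creprK !cmapE; apply: cclass_ext => n /=.
exact: fg.
Qed.

Lemma cmap_continuous (X Y : quasimetric R) (f : X -> Y) (uf : uniform_map f) :
  continuous (cmap uf).
Proof.
apply/continuousP => U; rewrite !completion_openE => oU x /= /oU[e e0 eU].
have [d d0 df] := uf _ (divr_gt0 e0 (ltr0Sn R 1)).
exists d => // y /cdist_lt xy; apply: eU.
apply: (@le_lt_trans _ _ (e / 2)); last by lra.
by apply: cdist_le; near=> n; apply/ltW/df; near: n.
Unshelve. all: by end_near. Qed.

End CompletionMap.

Lemma closure_image (S T : topologicalType) (f : S -> T) (A : set S) (B : set T) x :
  continuous f -> (forall a, A a -> B (f a)) -> closure A x -> closure B (f x).
Proof.
move=> cf AB Ax V /cf /Ax[a [Aa Va]]; exists (f a); split => //; exact: AB.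
Qed.

Section Hull.
Variables (R : realType) (C : Type) (T0 : @tiling R C).

Definition G_orbit : set (@tiling R C) := range (fun g => tiling_act g T0).

Definition orbit_quasimetric : quasimetric R :=
  @Quasimetric R G_orbit (fun x y => delta (set_val x) (set_val y))
    (fun x => delta_xx _) (fun x y => delta_ge0 _ _)
    (fun y x z => delta_tri _ _ _)
    (fun e e0 => let: ex_intro2 f f0 fP := delta_sym C e0 in
      ex_intro2 _ _ f f0 (fun x y => fP (set_val x) (set_val y))).

Definition hull : Type := completion orbit_quasimetric.

HB.instance Definition _ := Topological.on hull.

Definition G_orbit_pt (g : aff R) : G_orbit :=
  set_elt (mem_set (imageT (fun h => tiling_act h T0) g)).

Definition hull_embed (x : G_orbit) : hull := @cembed R orbit_quasimetric x.

Definition hull_pt (g : aff R) : hull := hull_embed (G_orbit_pt g).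

Lemma G_orbit_act_subproof (g : aff R) (x : G_orbit) :
  tiling_act g (set_val x) \in G_orbit.
Proof.
have [h _ hx] := set_mem (valP x); rewrite set_valE -hx -tiling_actM.
exact/mem_set/(imageT (fun k => tiling_act k T0)).
Qed.

Definition G_orbit_act (g : aff R) (x : G_orbit) : G_orbit :=
  set_elt (G_orbit_act_subproof g x).

Lemma G_orbit_act_uniform g :
  @uniform_map R orbit_quasimetric orbit_quasimetric (G_orbit_act g).
Proof. by move=> e /(delta_act C g)[d d0 dP]; exists d => // x y; exact: dP. Qed.

Definition hull_act (g : aff R) : hull -> hull := cmap (G_orbit_act_uniform g).

Lemma G_orbit_actM g h : G_orbit_act g \o G_orbit_act h =1 G_orbit_act (aff_mul g h).
Proof. by move=> x; apply: val_inj; rewrite /= !set_valE tiling_actM. Qed.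

Lemma hull_actM g h x : hull_act (aff_mul g h) x = hull_act g (hull_act h x).
Proof. by apply/esym/cmap_comp; exact: G_orbit_actM. Qed.

Lemma hull_act1 x : hull_act (aff1 R) x = x.
Proof. by apply: cmap_id => y; apply: val_inj; rewrite /= tiling_act1. Qed.

Lemma hull_act_continuous g : continuous (hull_act g).
Proof. exact: cmap_continuous. Qed.

Lemma hull_act_pt g h : hull_act g (hull_pt h) = hull_pt (aff_mul g h).
Proof.
rewrite /hull_act /hull_pt /hull_embed cmap_embed; congr cembed.
by apply: val_inj; rewrite /= tiling_actM.
Qed.

End Hull.

Section Penrose.
Variable R : realType.

(* R^q S^n, with R(z) = 2 z and S(z) = z + 1 *)
Definition affRS (q n : int) : aff R :=
  aff_mul (dilation (exprz_gt0 q (ltr0Sn R 1))) (translation n%:~R).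

Definition penrose (C : Type) (w : int -> C) : @tiling R C :=
  [set p | exists q n : int, p = tile_act (affRS q n) (prototile R, w (- q))].

(* tilings are always coloured: the uncoloured one has the single colour tt *)
Definition penrose0 : @tiling R unit := penrose (fun=> tt).

End Penrose.

Arguments G_orbit {R C} T0 _.
Arguments penrose R {C} w _.
Arguments penrose0 R : clear implicits.

Section Suspension.
Variable R : realType.

Definition N_hull : set (hull (penrose0 R)) :=
  closure (range (fun t => hull_pt (penrose0 R) (translation t))).

Lemma N_hull_base : hull_pt (penrose0 R) (aff1 R) \in N_hull.
Proof. by apply/mem_set/subset_closure; exists 0. Qed.

Definition N_base : N_hull := set_elt N_hull_base.

Lemma N_translate_subproof (t : R) (T : N_hull) :
  hull_act (translation t) (set_val T) \in N_hull.
Proof.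
have /set_mem := valP T; rewrite -set_valE => cT; apply/mem_set; move: cT.
apply: closure_image; first exact: hull_act_continuous.
move=> _ [s _ <-]; exists (s + t) => //; rewrite hull_act_pt.
by congr hull_pt; apply: aff_eq => /=; ring.
Qed.

Definition N_translate (t : R) (T : N_hull) : N_hull :=
  set_elt (N_translate_subproof t T).

Lemma affR_penrose0 (g : aff R) :
  hull_pt (penrose0 R) (aff_mul g (affR R)) = hull_pt (penrose0 R) g.
Proof.
rewrite /hull_pt; congr (hull_embed _); apply: val_inj => /=.
rewrite tiling_actM; congr tiling_act.
apply/funext => p; apply/propext; rewrite tiling_actE.
have -> : p = tile_act (affR R) (tile_act (aff_inv (affR R)) p).
  by rewrite -tile_actM aff_mulgV tile_act1.
move: (tile_act _ p) => {}p; rewrite -!tile_actM aff_mulVg tile_act1.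
have RE (q n : int) : affRS R (q + 1) n = aff_mul (affR R) (affRS R q n).
  by apply: aff_eq; rewrite /= exprzDr ?unitfE ?pnatr_eq0// expr1z; ring.
split=> -[q [n]].
  by move=> ->; exists (q + 1), n; rewrite RE tile_actM.
rewrite -(subrK 1 q) RE tile_actM => pE; exists (q - 1), n.
by rewrite -[p]tile_act1 -(aff_mulVg (affR R)) tile_actM pE -tile_actM
  aff_mulVg tile_act1.
Qed.

Lemma N_map_subproof (a : aff R) (T : N_hull) :
  a = affR R \/ a = aff_inv (affR R) -> hull_act a (set_val T) \in N_hull.
Proof.
move=> aR; have /set_mem := valP T; rewrite -set_valE => cT; apply/mem_set.
move: cT; apply: closure_image; first exact: hull_act_continuous.
move=> _ [s _ <-]; exists (scale a * s) => //; rewrite hull_act_pt.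
have -> : aff_mul a (translation s) = aff_mul (translation (scale a * s)) a.
  by case: aR => ->; apply: aff_eq => /=; ring.
case: aR => ->; first by rewrite affR_penrose0.
by rewrite -[RHS]affR_penrose0 -aff_mulA aff_mulVg aff_mulg1.
Qed.

Definition N_R (T : N_hull) : N_hull :=
  set_elt (N_map_subproof T (or_introl (erefl (affR R)))).

Definition N_RV (T : N_hull) : N_hull :=
  set_elt (N_map_subproof T (or_intror (erefl (aff_inv (affR R))))).

Lemma N_RK : cancel N_R N_RV.
Proof.
by move=> T; apply: val_inj; rewrite /= !set_valE/= -hull_actM aff_mulVg hull_act1.
Qed.

Lemma N_RVK : cancel N_RV N_R.
Proof.
by move=> T; apply: val_inj; rewrite /= !set_valE/= -hull_actM aff_mulgV hull_act1.
Qed.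

Lemma N_R_translate t T : N_R (N_translate t T) = N_translate (2 * t) (N_R T).
Proof.
apply: val_inj; rewrite /= !set_valE/= -!hull_actM; congr hull_act.
by apply: aff_eq => /=; ring.
Qed.

Section Subshift.
Variable r : nat.

Definition config : Type := prod_topology (fun _ : int => discrete_topology 'I_r).

HB.instance Definition _ := Topological.on config.

Definition shift_config (n : int) (w : config) : config := fun k => w (k + n).

Lemma shift_continuous n : continuous (shift_config n).
Proof.
move=> x; apply/cvg_sup; first exact/fmap_filter/nbhs_filter.
move=> i; move: x.
apply/(@continuousP _ (initial_topology (@^~ i))) => A [B oB <-].
rewrite (_ : _ @^-1` _ = proj (i + n) @^-1` B)//.
by apply: open_comp => // y _; exact: proj_continuous.
Qed.

Definition subshift (w : config) : set config := closure (range (shift_config^~ w)).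

Variable w : config.

Lemma subshift_base_subproof : w \in subshift w.
Proof.
apply/mem_set/subset_closure; exists 0 => //.
by apply/funext => k; rewrite /shift_config addr0.
Qed.

Definition subshift_base : subshift w := set_elt subshift_base_subproof.

Lemma subshift_shift_subproof n (v : subshift w) :
  shift_config n (set_val v) \in subshift w.
Proof.
have /set_mem := valP v; rewrite -set_valE => cv; apply/mem_set; move: cv.
apply: closure_image; first exact: shift_continuous.
move=> _ [m _ <-]; exists (n + m) => //.
by apply/funext => k; rewrite /shift_config addrA.
Qed.

Definition subshift_shift n (v : subshift w) : subshift w :=
  set_elt (subshift_shift_subproof n v).

Lemma subshift_shiftK n : cancel (subshift_shift n) (subshift_shift (- n)).
Proof.
move=> v; apply: val_inj; apply/funext => k /=.
by rewrite !set_valE /= /shift_config subrK.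
Qed.

Definition posreals : set R := [set t | 0 < t].

Lemma posreals_mul_subproof (a : R) (t : posreals) :
  0 < a -> a * set_val t \in posreals.
Proof. by move=> a0; apply/mem_set/mulr_gt0 => //; exact: set_mem (valP t). Qed.

Definition posreals_mul (a : R) (a0 : 0 < a) (t : posreals) : posreals :=
  set_elt (posreals_mul_subproof t a0).

Definition posreals1 : posreals := set_elt (mem_set (ltr01 : posreals 1)).

Lemma posreal_half_gt0 : 0 < 2^-1 :> R. Proof. by rewrite invr_gt0. Qed.

Definition presuspension : Type := (N_hull * subshift w * posreals)%type.

HB.instance Definition _ := Topological.on presuspension.

Definition presuspension_base : presuspension :=
  (N_base, subshift_base, posreals1).

Definition suspension_map (x : presuspension) : presuspension :=
  let: (T, v, t) := x in
  (N_R T, subshift_shift 1 v, posreals_mul posreal_half_gt0 t).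

Definition presuspension_act (g : aff R) (x : presuspension) : presuspension :=
  let: (T, v, t) := x in
  (N_translate (trans g / (scale g * set_val t)) T, v,
   posreals_mul (scale_gt0 g) t).

Lemma suspension_map_inj : injective suspension_map.
Proof.
move=> [[T v] t] [[T' v'] t'] /= [].
move=> TT vv tt; congr (_, _, _).
- by apply: (can_inj N_RK); apply: val_inj.
- by apply: (can_inj (subshift_shiftK 1)); apply: val_inj.
- by apply: val_inj; move: tt => /mulfI; apply; rewrite gt_eqF ?posreal_half_gt0.
Qed.

Lemma suspension_map_act g x :
  suspension_map (presuspension_act g x) = presuspension_act g (suspension_map x).
Proof.
case: x => [[T v] t] /=; rewrite N_R_translate; congr (_, _, _).
  congr (N_translate _ _).
  have -> : set_val (posreals_mul posreal_half_gt0 t) = 2^-1 * set_val t by [].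
  have a0 := scale_gt0 g; have : 0 < set_val t := set_mem (valP t).
  by move: (set_val t) => s s0; field; rewrite !gt_eqF.
by apply: val_inj; exact: mulrCA.
Qed.

(* [suspension_map] is bijective, so these are the orbits of its iterates with
   exponents of both signs *)
Definition same_orbit (x y : presuspension) : bool :=
  `[< exists n : nat,
      iter n suspension_map x = y \/ iter n suspension_map y = x >].

Lemma same_orbit_refl : reflexive same_orbit.
Proof. by move=> x; apply/asboolP; exists 0%N; left. Qed.

Lemma same_orbit_sym : symmetric same_orbit.
Proof.
by move=> x y; apply/asboolP/asboolP => -[n [|]]; exists n; [right|left|right|left].
Qed.

Let iter_inj n : injective (iter n suspension_map).
Proof. by elim: n => // n IH x y /= /suspension_map_inj /IH. Qed.

Lemma same_orbit_trans : transitive same_orbit.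
Proof.
have iterB m n x : (m <= n)%N ->
    iter n suspension_map x = iter m suspension_map (iter (n - m) suspension_map x).
  by move=> mn; rewrite -iterD subnKC.
move=> y x z /asboolP[m xy] /asboolP[n yz]; apply/asboolP.
case: xy yz => xy [yz|yz].
- by exists (n + m)%N; left; rewrite iterD xy.
- case: (leqP m n) => [mn|/ltnW nm].
    exists (n - m)%N; right; apply: (@iter_inj m).
    by rewrite -iterB// yz xy.
  exists (m - n)%N; left; apply: (@iter_inj n).
  by rewrite -iterB// yz xy.
- case: (leqP m n) => [mn|/ltnW nm].
    exists (n - m)%N; left.
    by rewrite -xy -iterD subnK.
  exists (m - n)%N; right.
  by rewrite -yz -iterD subnK.
- by exists (m + n)%N; right; rewrite iterD yz.
Qed.

Canonical same_orbit_equivalence := EquivRel same_orbit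
  same_orbit_refl same_orbit_sym same_orbit_trans.

Definition suspension : Type :=
  quotient_topology {eq_quot same_orbit_equivalence}%qT.

HB.instance Definition _ := Topological.on suspension.

Definition suspension_class (x : presuspension) : suspension :=
  \pi_({eq_quot same_orbit_equivalence})%qT x.

Lemma suspension_classP x y :
  suspension_class x = suspension_class y <-> same_orbit x y.
Proof. by split=> [/eqmodP|xy]; last exact/eqmodP. Qed.

Definition suspension_act (g : aff R) (x : suspension) : suspension :=
  suspension_class (presuspension_act g (repr x)).

Lemma suspension_actE g x :
  suspension_act g (suspension_class x) =
  suspension_class (presuspension_act g x).
Proof.
have iterE n y : iter n suspension_map (presuspension_act g y) =
    presuspension_act g (iter n suspension_map y).
  by elim: n => //= n ->; rewrite suspension_map_act.
apply/suspension_classP.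
have /suspension_classP/asboolP[n xE] :
  suspension_class (repr (suspension_class x)) = suspension_class x := reprK _.
by apply/asboolP; exists n; case: xE => xE; [left|right]; rewrite iterE xE.
Qed.

End Subshift.
End Suspension.

Definition homeomorphism (S T : topologicalType) (f : S -> T) : Prop :=
  continuous f /\ exists f', [/\ cancel f f', cancel f' f & continuous f'].

Definition conjugacy (G : Type) (S T : topologicalType)
  (actS : G -> S -> S) (actT : G -> T -> T) (f : S -> T) : Prop :=
  homeomorphism f /\ forall g x, f (actS g x) = actT g (f x).

(* Main.v *)
Require Import Defs.
From mathcomp Require Import all_boot all_order all_algebra.
From mathcomp Require Import all_classical all_reals.
From mathcomp Require Import topology normedtype sequences exp.
From mathcomp Require Import ring lra zify.
Import Order.TTheory GRing.Theory Num.Theory.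
Import numFieldNormedType.Exports.

Set Implicit Arguments.
Unset Strict Implicit.
Unset Printing Implicit Defensive.

Local Open Scope classical_set_scope.
Local Open Scope ring_scope.

(* Near the point i, the tiling g.P(w) is determined up to a small motion by the
   colours of the levels in a long window around level 0, by the scale of g, and
   by its translation modulo the width 2 ^ n of the widest tiles in sight.
   Conversely the tiles near i determine these data, except that the scale is
   only known up to a power of 2, which R absorbs by shifting w.  Hence
   (T, v, t) |-> t . lim (P(sigma^(m_n) w) + s_n), where T = lim (P + s_n) and
   v = lim sigma^(m_n) w, is a continuous map from the presuspension onto the
   hull; its fibres are the orbits of [suspension_map], and up to these orbits
   it is open.  The induced map on the suspension is the inverse of Phi. *)

(** The suspension is built as a bare quotient: it carries no metric in which limits of Psi along
    Cauchy sequences could be taken, whereas the hull is a completion. This is why the map goes from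
    the presuspension into the hull and is inverted only at the end. The estimates on tilings hold
    for any type of colours, with constants fixed before that type. With the single colour [tt] they
    compare uncoloured tilings, and [solenoid_close] is the currency in which closeness of the
    tilings T and of the colour sequences v is exchanged for closeness of coloured tilings, and
    conversely. The undetermined power of 2 is removed by normalising: if two scales in [7/8, 9/8]
    agree up to a power of 2 and an error 1/8, that power is 1. Injectivity and openness modulo
    orbits, and surjectivity, all come down to this case. *)

Section AffineNorm.
Variable R : realType.

(** * Distance to the identity in the affine group, and hyperbolic balls *)

Lemma ln_le_arcosh (u : R) : 1 <= u -> ln u <= arcosh u.
Proof.
move=> u1; rewrite /arcosh ler_ln ?posrE ?lerDl ?sqrtr_ge0//; first by lra.
by have := sqrtr_ge0 (u ^+ 2 - 1); lra.
Qed.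

Lemma arcosh_le_ln (u : R) : 1 <= u -> arcosh u <= ln (2 * u).
Proof.
move=> u1; have s0 := sqrtr_ge0 (u ^+ 2 - 1).
rewrite /arcosh ler_ln ?posrE; [|lra|lra].
suff : Num.sqrt (u ^+ 2 - 1) <= u by lra.
rewrite -[leRHS]ger0_norm; last by lra.
by rewrite -sqrtr_sqr ler_wsqrtr//; lra.
Qed.

Lemma arcosh_lt (e : R) : 0 < e -> exists2 f, 0 < f &
  forall u, 1 <= u -> u - 1 <= f -> arcosh u < e.
Proof.
move=> e0; pose m := Num.min 1 (e / 4).
have m0 : 0 < m by rewrite lt_min ltr01 divr_gt0.
have m1 : m <= 1 by rewrite ge_min lexx.
have m2 : m <= e / 4 by rewrite ge_min lexx orbT.
(* If u - 1 <= m^2 / 3 with m <= 1, then u + 1 < 3 and u^2 - 1 = (u - 1)(u + 1) <= m^2. *)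
exists (m ^+ 2 / 3); first by rewrite divr_gt0// exprn_gt0.
move=> u u1 uf; have s0 := sqrtr_ge0 (u ^+ 2 - 1).
have mm : m ^+ 2 <= m by nra.
have : Num.sqrt (u ^+ 2 - 1) <= m.
  rewrite -(ger0_norm (ltW m0)) -sqrtr_sqr ler_wsqrtr//; nra.
rewrite /arcosh.
have -> : u + Num.sqrt (u ^+ 2 - 1) = 1 + (u - 1 + Num.sqrt (u ^+ 2 - 1)) by ring.
move=> sm; apply: le_lt_trans (le_ln1Dx _) _; lra.
Qed.

Lemma hcosh_imI_aff (g : aff R) : hcosh (imI R) (aff_pt g (imI R)) - 1 =
  (trans g ^+ 2 + (scale g - 1) ^+ 2) / (2 * scale g).
Proof.
have g0 := lt0r_neq0 (scale_gt0 g).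
by rewrite /hcosh /=; field.
Qed.

Lemma hcosh_imI_aff_ge1 (g : aff R) : 1 <= hcosh (imI R) (aff_pt g (imI R)).
Proof. by apply: hcosh_ge1; [exact: halfplane_imI|exact/halfplane_aff/halfplane_imI]. Qed.

Lemma aff_norm_lt (e : R) : 0 < e -> exists2 f, 0 < f &
  forall g, `|scale g - 1| <= f -> `|trans g| <= f -> aff_norm g < e.
Proof.
move=> /arcosh_lt[f f0 fP].
pose m := Num.min (1/2) f.
have m0 : 0 < m by rewrite lt_min f0 andbT; lra.
have m1 : m <= 1/2 by rewrite ge_min lexx.
have m2 : m <= f by rewrite ge_min lexx orbT.
exists (m / 2); first by rewrite divr_gt0.
move=> g; rewrite !ler_norml => /andP[g1 g2] /andP[g3 g4].
apply: fP; first exact: hcosh_imI_aff_ge1.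
rewrite hcosh_imI_aff ler_pdivrMr; last by rewrite mulr_gt0 ?scale_gt0.
apply: le_trans (_ : m ^+ 2 / 2 <= _); first by nra.
nra.
Qed.

Lemma aff_norm_small (e : R) : 0 < e -> exists2 f, 0 < f &
  forall g, aff_norm g < f -> `|scale g - 1| <= e /\ `|trans g| <= e.
Proof.
(* With a the scale and b the translation, the bound is b^2 + (a - 1)^2 < 2 a d. Here d <= 1 forces
   a <= 4, so the right side is at most 8 d <= e^2. *)
move=> e0; pose d := Num.min 1 (e ^+ 2 / 8).
have d0 : 0 < d by rewrite lt_min ltr01 divr_gt0// exprn_gt0.
have d1 : d <= 1 by rewrite ge_min lexx.
have d2 : d <= e ^+ 2 / 8 by rewrite ge_min lexx orbT.
exists (ln (1 + d)); first by rewrite -ln1 ltr_ln ?posrE//; lra.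
move=> g gd; have u1 := hcosh_imI_aff_ge1 g.
have := le_lt_trans (ln_le_arcosh u1) gd.
rewrite ltr_ln ?posrE; [|lra|lra].
rewrite -ltrBlDl hcosh_imI_aff ltr_pdivrMr; last by rewrite mulr_gt0 ?scale_gt0.
have a0 := scale_gt0 g; move: (scale g) (trans g) a0 => a b a0 H.
have b2 := sqr_ge0 b; have da : d * (2 * a) <= 2 * a by rewrite ger_pMl ?mulr_gt0.
have a4 : a <= 4 by nra.
have da' : d * (2 * a) <= d * 8 by rewrite ler_pM2l//; lra.
have H2 : b ^+ 2 + (a - 1) ^+ 2 <= e ^+ 2 by lra.
have a2 := sqr_ge0 (a - 1).
rewrite -(ler_sqr (x := `|a - 1|)) ?nnegrE ?normr_ge0 ?(ltW e0)//.
rewrite -(ler_sqr (x := `|b|)) ?nnegrE ?normr_ge0 ?(ltW e0)// !real_normK ?num_real//.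
by split; lra.
Qed.

(** The cosh of the distance from i to x + iy is (1 + x^2 + y^2) / (2 y), which dominates both y / 2
    and 1 / (2 y). The factor 2 against the sharp strip comes from using ln <= arcosh. *)
Lemma hball_height (rho : R) z : hball rho z ->
  z.2 <= 2 * expR rho /\ (2 * expR rho)^-1 <= z.2.
Proof.
move=> [z0 zr]; have z0' : 0 < z.2 := z0.
have u1 : 1 <= hcosh (imI R) z by apply: hcosh_ge1 => //; exact: halfplane_imI.
have := le_lt_trans (ln_le_arcosh u1) zr.
rewrite -[ltRHS]expRK ltr_ln ?posrE ?expR_gt0//; last by lra.
have E0 : 0 < expR rho := expR_gt0 _.
have -> : hcosh (imI R) z = (1 + z.1 ^+ 2 + z.2 ^+ 2) / (2 * z.2).
  by rewrite /hcosh /=; field; rewrite gt_eqF.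
rewrite ltr_pdivrMr ?mulr_gt0// => H; move: (expR rho) E0 H => E E0 H.
have x0 := sqr_ge0 z.1.
split; first by nra.
by rewrite -div1r ler_pdivrMr ?mulr_gt0//; nra.
Qed.

Lemma hball_vertical (M y : R) : 0 < y -> y <= M -> y^-1 <= M ->
  hball (ln (2 * M) + 1) (0, y).
Proof.
move=> y0 yM yM'; split; first exact: y0.
have u1 : 1 <= hcosh (imI R) (0, y) by apply: hcosh_ge1 => //; exact: halfplane_imI.
apply: le_lt_trans (arcosh_le_ln u1) _; rewrite ltr_pwDr// ler_ln ?posrE; [|lra|lra].
rewrite ler_pM2l//.
have -> : hcosh (imI R) (0, y) = (y + y^-1) / 2.
  by rewrite /hcosh /=; field; rewrite gt_eqF.
by lra.
Qed.

End AffineNorm.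

(** * Geometry of the prototile *)

Section Prototile.
Variable R : realType.

Lemma prototile_bounds (z : R * R) : prototile R z ->
  [/\ 0 <= z.1 <= 1, 1 <= z.2 & z.2 <= 5/2].
Proof.
rewrite prototileE => -[y0 x01 h1 h2 h3]; split => //.
  (* The lower boundary is the arc centred at 1/4 over [0, 1/2] and the one centred at 3/4 over
     [1/2, 1]. *)
  by case/andP: x01 => x0 x1; have [x2|/ltW x2] := leP z.1 (1/2); nra.
by nra.
Qed.

Lemma prototile_vertex0 : prototile R (0, 1).
Proof. by rewrite prototileE; split => //=; lra. Qed.

(** A horizontal segment crossing the whole prototile: the tiles of one level thus cover a full
    horizontal line, and every level has a tile above the point 0. *)
Lemma prototile_center (x : R) : 0 <= x <= 1 -> prototile R (x, 3/2).
Proof. by rewrite prototileE => /andP[x0 x1]; split => //=; [lra|lra|nra|nra|nra]. Qed.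

(** The corner (0, 1) has both the least abscissa and the least height in the prototile, and g sends
    it to ([trans g], [scale g]); so g can be read off its tile. *)
Lemma aff_prototile_inj (g h : aff R) :
  aff_pt g @` prototile R = aff_pt h @` prototile R -> g = h.
Proof.
suff H (g' h' : aff R) : aff_pt g' @` prototile R = aff_pt h' @` prototile R ->
    scale h' <= scale g' /\ trans h' <= trans g'.
  move=> gh; have [s1 t1] := H _ _ gh; have [s2 t2] := H _ _ (esym gh).
  by apply: aff_eq; apply/eqP; rewrite eq_le ?s1 ?t1 ?s2 ?t2.
move=> gh; have : (aff_pt g' @` prototile R) (aff_pt g' (0, 1)).
  by exists (0, 1) => //; exact: prototile_vertex0.
rewrite gh => -[z /prototile_bounds[/andP[x0 x1] y1 _]].
rewrite /aff_pt /= => -[]; have := scale_gt0 h'; nra.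
Qed.

Lemma tile_act_prototile_inj (C : Type) (g h : aff R) (c d : C) :
  tile_act g (prototile R, c) = tile_act h (prototile R, d) -> g = h /\ c = d.
Proof. by case => /aff_prototile_inj -> ->. Qed.

End Prototile.

(** * Penrose tilings near i and their parameters: scale, translation, colours *)

Section Penrose.
Variable R : realType.

Definition pow2_dilation (j : int) : aff R := dilation (exprz_gt0 j (ltr0Sn R 1)).

Lemma pow2_gt0 (j : int) : 0 < (2 : R) ^ j.
Proof. exact: exprz_gt0. Qed.

Lemma pow2D (i j : int) : (2 : R) ^ (i + j) = 2 ^ i * 2 ^ j.
Proof. by rewrite exprzDr// unitfE pnatr_eq0. Qed.

Lemma pow2_mono (i j : int) : ((2 : R) ^ i <= 2 ^ j) = (i <= j).
Proof. by rewrite ler_eXz2l// ltr1n. Qed.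

Lemma pow2_inj : injective (exprz (2 : R)).
Proof. by move=> i j ij; apply/eqP; rewrite eq_le -!pow2_mono ij !lexx. Qed.

(** Level q carries the colour w (-q); with this sign, raising all tiles by j levels is the j-th
    power of the shift itself and not of its inverse. *)
Lemma penrose_pow2 (C : Type) (w : int -> C) (j : int) :
  tiling_act (pow2_dilation j) (penrose R w) = penrose R (fun k => w (k + j)).
Proof.
have RSE (i q n : int) :
    aff_mul (pow2_dilation i) (affRS R q n) = affRS R (i + q) n.
  by apply: aff_eq; rewrite /= pow2D; ring.
apply/funext => p; apply/propext; split.
  move=> [_ [q [n ->]] <-]; exists (j + q), n.
  rewrite -tile_actM RSE; congr (tile_act _ (_, w _)); ring.
move=> [q [n ->]]; exists (tile_act (affRS R (q - j) n) (prototile R, w (- q + j))).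
  by exists (q - j), n; congr (tile_act _ (_, w _)); ring.
by rewrite -tile_actM RSE; congr tile_act; congr affRS; ring.
Qed.

Lemma ball_levels (rho : R) : exists n : nat, forall (q : int) (g : aff R) (z : R * R),
  scale g = 2 ^ q -> prototile R z -> hball rho (aff_pt g z) -> - n%:Z <= q <= n%:Z.
Proof.
have E0 : 0 < expR rho := expR_gt0 _.
(* Prototile heights are at most 5/2 and the ball lies above height 1 / (2 e^rho), whence 2^(-q) <=
   5 e^rho; the other side needs only 2 e^rho. *)
have [n nE] : exists n : nat, 5 * expR rho < 2 ^+ n :> R.
  have [n nE] : exists n : nat, 5 * expR rho < n%:R.
    exists (Num.bound (5 * expR rho)).
    by apply: archi_boundP; rewrite mulr_ge0// ltW.
  exists n; apply: lt_trans nE _.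
  by rewrite -natrX ltr_nat; exact: ltn_expl.
exists n => q g z gq /prototile_bounds[_ z1 z2] /hball_height /=.
rewrite gq => -[h1 h2]; have q0 := pow2_gt0 q.
have nn : (2 : R) ^ n%:Z = 2 ^+ n by [].
apply/andP; split; rewrite -pow2_mono.
  rewrite -invr_expz nn invf_ple ?posrE ?exprn_gt0//.
  have z0 : 0 < z.2 by lra.
  have qV : 0 < (2 ^ q)^-1 :> R by rewrite invr_gt0.
  apply: (le_trans _ (ltW nE)).
  move: h2; rewrite -div1r ler_pdivrMr ?mulr_gt0// => h2.
  rewrite -div1r ler_pdivrMr//; nra.
rewrite nn; nra.
Qed.

(* On translations of the uncoloured tiling this is the uniformity of the
   dyadic solenoid, the inverse limit of the circles R / 2 ^ n Z. *)
Definition solenoid_close (n : nat) (s s' : R) : Prop :=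
  exists z : int, `|s' - s - 2 ^+ n * z%:~R| <= (2 ^+ n)^-1.

Definition window_eq (n : nat) (C : Type) (w w' : int -> C) : Prop :=
  forall k : int, - n%:Z <= k <= n%:Z -> w k = w' k.

Lemma penrose_agree (e : R) : 0 < e -> exists n : nat,
  forall (C : Type) (w w' : int -> C) (s s' : R),
  solenoid_close n s s' -> window_eq n w w' ->
  agree e (tiling_act (translation s) (penrose R w))
    (tiling_act (translation s') (penrose R w')).
Proof.
move=> e0; have [f f0 fP] := aff_norm_lt e0.
have [n1 n1P] := ball_levels e^-1.
have [n2 n2P] : exists n : nat, f^-1 < n%:R.
  exists (Num.bound f^-1).
  by apply: archi_boundP; rewrite invr_ge0 ltW.
exists (maxn n1 n2); set n := maxn n1 n2 => C w w' s s' [z zn] ww'.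
pose eta : R := s' - s - 2 ^+ n * z%:~R.
exists (translation eta); split.
  apply: fP; rewrite /= ?subrr ?normr0 ?(ltW f0)//.
  apply: (le_trans zn); rewrite invf_ple ?posrE ?exprn_gt0//.
  apply: (le_trans (ltW n2P)); rewrite -natrX ler_nat.
  apply: leq_trans (leq_maxr n1 n2) _; exact/ltnW/ltn_expl.
have levels (q : int) (g : aff R) (x : R * R) : scale g = 2 ^ q ->
    prototile R x -> hball e^-1 (aff_pt g x) -> - n%:Z <= q <= n%:Z.
  move=> gq xP xb; have := n1P q g x gq xP xb.
  have : (n1 <= n)%N by exact: leq_maxl.
  lia.
apply/coincideP => p [x [px xb]].
(* levels q <= n are invariant under translation by multiples of 2 ^ n *)
have half (c : R) (y : int) (u u' : int -> C) :
    window_eq n u u' ->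
    tiling_act (translation c) (penrose R u) p ->
    tiling_act (translation (c + 2 ^+ n * y%:~R)) (penrose R u') p.
  move=> uu' [_ [q [m ->]] pE].
  have qn : - n%:Z <= q <= n%:Z.
    move: px; rewrite -pE -tile_actM /= => -[v vP vx].
    apply: (levels q (aff_mul (translation c) (affRS R q m)) v _ vP).
      by rewrite /= mul1r mulr1.
    by rewrite vx.
  (* A block of width 2^n holds 2^(n - q) tiles of level q, which gives the change of index. *)
  exists (tile_act (affRS R q (m - 2 ^+ `|n%:Z - q|%N * y)) (prototile R, u' (- q))).
    by do 2 eexists.
  rewrite -pE -!tile_actM uu'; last by lia.
  have castE : (m - 2 ^+ `|n%:Z - q|%N * y)%:~R =
      m%:~R - 2 ^+ `|n%:Z - q|%N * y%:~R :> R.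
    by rewrite intrB intrM rmorphXn.
  have nE : (2 : R) ^+ n = 2 ^ q * 2 ^+ `|n%:Z - q|%N.
    have -> : (2 : R) ^+ `|n%:Z - q|%N = 2 ^ (n%:Z - q).
      by rewrite -[in RHS](gez0_abs (_ : 0 <= n%:Z - q)) ?subr_ge0; [|lia].
    by rewrite -pow2D addrC subrK.
  congr tile_act; apply: aff_eq => /=; first by ring.
  rewrite castE nE; ring.
rewrite -tiling_actM.
have -> : aff_mul (translation eta) (translation s) =
    translation (s' - 2 ^+ n * z%:~R).
  by apply: aff_eq => /=; rewrite /eta; ring.
split=> [/(half _ z _ w' ww')|].
  by rewrite subrK.
move=> /(half _ (- z) _ w (fun k kn => esym (ww' k kn))).
by rewrite mulrNz mulrN.
Qed.

(** In each level of the window, the tile above 0 meets the ball, hence is a tile of the second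
    tiling too; by [tile_act_prototile_inj] the scales, positions and colours then match level by
    level. *)
Lemma agree_penrose_inv (n : nat) : exists2 e : R, 0 < e &
  forall (C : Type) (w w' : int -> C) (t t' s s' : R) (t0 : 0 < t) (t0' : 0 < t'),
  1/2 <= t <= 2 ->
  agree e (tiling_act (aff_mul (dilation t0) (translation s)) (penrose R w))
    (tiling_act (aff_mul (dilation t0') (translation s')) (penrose R w')) ->
  exists j : int, [/\ `|t' * 2 ^ (- j) - t| <= (2 ^+ n)^-1,
    solenoid_close n s (2 ^ j * s') & window_eq n w (fun k => w' (k + j))].
Proof.
have nn : - n%:Z <= n%:Z <= n%:Z by lia.
have nN (i : int) : - n%:Z <= i <= n%:Z -> - n%:Z <= - i <= n%:Z by lia.
pose p : R := 2 ^+ n; have p1 : 1 <= p by rewrite exprn_ege1// ler1n.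
have p0 : 0 < p by lra.
have pV1 : p^-1 <= 1 by rewrite invf_le1.
have pV0 : 0 < p^-1 by rewrite invr_gt0.
have eps0 : 0 < p^-1 / 8 by rewrite divr_gt0.
have [f f0 fP] := aff_norm_small eps0.
(* 4 p bounds the heights 3/2 al 2^q used below and their inverses, since al lies in [7/16, 9/4] and
   2^q in [1/p, p]. *)
pose rho := ln (2 * (4 * p)) + 1.
have rho0 : 0 < rho by rewrite ltr_wpDl// ln_ge0//; lra.
pose e := Num.min f rho^-1.
have e0 : 0 < e by rewrite lt_min f0 invr_gt0.
have ef : e <= f by rewrite ge_min lexx.
have er : rho <= e^-1.
  by rewrite -[leLHS]invrK lef_pV2 ?posrE ?invr_gt0// ge_min lexx orbT.
exists e => // C w w' t t' s s' t0 t0' /andP[tl tu] [k [ke]].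
have [] := fP k (lt_le_trans ke ef).
rewrite !ler_norml => /andP[k1 k2] /andP[k3 k4].
rewrite -tiling_actM => /coincideP kP.
have k0 := scale_gt0 k.
set h := aff_mul k _ in kP.
pose al := scale k * t; pose be := trans k + al * s.
have h1 : scale h = al by rewrite /h /al /=; ring.
have h2 : trans h = be by rewrite /h /be /al /=; ring.
have al0 : 0 < al by rewrite mulr_gt0.
have al1 : 7/16 <= al by rewrite /al; nra.
have al2 : al <= 9/4 by rewrite /al; nra.
clearbody h.
have level (q : int) : - n%:Z <= q <= n%:Z -> exists q' m m' : int,
    [/\ al * 2 ^ q = t' * 2 ^ q', al * 2 ^ q * m%:~R + be = t' * 2 ^ q' * m'%:~R + t' * s'
      & w (- q) = w' (- q')].
  move=> /andP[qn nq]; have q0 := pow2_gt0 q.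
  have qp : 2 ^ q <= p by rewrite -[p]/(2 ^ n%:Z) pow2_mono.
  have pq : p^-1 <= 2 ^ q by rewrite -[p]/(2 ^ n%:Z) invr_expz pow2_mono.
  have a0 : 0 < al * 2 ^ q by rewrite mulr_gt0.
  (* m is the index of a tile of level q above 0, and th the abscissa of 0 in the frame of that
     tile. *)
  pose m := Num.floor (- be / (al * 2 ^ q)).
  pose th := - be / (al * 2 ^ q) - m%:~R.
  have th01 : 0 <= th <= 1.
    have /andP[m1 m2] := floor_itv (- be / (al * 2 ^ q)).
    rewrite /th -/m; move: m1 m2; rewrite -/m intrD mulr1z; lra.
  have ptE : aff_pt (aff_mul h (affRS R q m)) (th, 3/2) = (0, 3/2 * (al * 2 ^ q)).
    rewrite /aff_pt /= h1 h2; congr pair; last by ring.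
    by rewrite /th; field; rewrite !gt_eqF.
  have : tiling_act h (penrose R w)
      (tile_act (aff_mul h (affRS R q m)) (prototile R, w (- q))).
    by exists (tile_act (affRS R q m) (prototile R, w (- q))); [exists q, m|rewrite -tile_actM].
  have inb : (tile_act (aff_mul h (affRS R q m)) (prototile R, w (- q))).1 `&`
      hball e^-1 !=set0.
    exists (0, 3/2 * (al * 2 ^ q)); split.
      by exists (th, 3/2) => //; exact: prototile_center.
    have [y0 yr] : hball rho (0, 3/2 * (al * 2 ^ q)).
      apply: hball_vertical; first by rewrite mulr_gt0//; lra.
        have : al * 2 ^ q <= 9/4 * p by apply: ler_pM => //; exact: ltW.
        lra.
      have : 7/16 * p^-1 <= al * 2 ^ q by apply: ler_pM => //; [lra|exact: ltW].
      move=> H; rewrite -div1r ler_pdivrMr; last by lra.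
      have pp : p * p^-1 = 1 by rewrite mulfV// gt_eqF.
      nra.
    by split=> //; exact: lt_le_trans er.
  move=> /(kP _ inb)[_ [q' [m' ->]]]; rewrite -tile_actM.
  move=> tE; have [E wE] := tile_act_prototile_inj (esym tE).
  exists q', m, m'; split => //.
    by have := congr1 (@scale R) E; rewrite /= h1 !mulr1.
  by have := congr1 (@trans R) E; rewrite /= h1 h2 !(mulr1, mul1r, addr0) !mulrA => ->.
(* 2^q / 2^q' is t' / al at every level, so a single shift j serves the whole window. *)
have jE (q q' q1 q1' : int) : al * 2 ^ q = t' * 2 ^ q' ->
    al * 2 ^ q1 = t' * 2 ^ q1' -> q1 - q1' = q - q'.
  move=> qq qq1; apply: (@pow2_inj); rewrite !pow2D -!invr_expz.
  have H (a b : int) : al * 2 ^ a = t' * 2 ^ b -> 2 ^ a / 2 ^ b = t' / al.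
    move=> ab; have a0 := pow2_gt0 b.
    have -> : (2 : R) ^ a = t' * 2 ^ b / al by rewrite -ab mulrAC mulfV ?mul1r// gt_eqF.
    by field; rewrite !gt_eqF.
  by rewrite (H q1 q1')// (H q q').
have [q' [m [m' [aE bE _]]]] := level _ nn.
have {}jE q1 q1' := jE n%:Z q' q1 q1' aE.
pose j := n%:Z - q'.
have alE : al = t' * 2 ^ (- j).
  have -> : - j = q' + - n%:Z by rewrite /j; ring.
  rewrite pow2D mulrA -aE -invr_expz mulfK// gt_eqF// pow2_gt0//.
exists j; split.
- rewrite -alE -/p /al.
  have -> : scale k * t - t = t * (scale k - 1) by ring.
  by rewrite ler_norml; apply/andP; split; nra.
(* Level n, the widest, fixes the translation modulo 2^n up to the drift [trans k] of the small
   motion. *)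
- exists (m - m'); rewrite -/p.
  have tE : 2 ^ j = t' / al.
    rewrite alE -invr_expz invfM invrK mulrA mulfV ?mul1r// gt_eqF//.
  have -> : 2 ^ j * s' - s - p * (m - m')%:~R = trans k / al.
    apply: (@mulfI _ al); first by rewrite gt_eqF.
    rewrite [RHS]mulrCA mulfV ?mulr1 ?gt_eqF// tE intrB.
    move: bE; rewrite -aE /be -[2 ^ n]/p => bE.
    have -> : al * (t' / al * s' - s - p * (m%:~R - m'%:~R)) =
      t' * s' - al * s - al * p * (m%:~R - m'%:~R) by field; rewrite gt_eqF.
    lra.
  rewrite ler_norml ler_pdivlMr// ler_pdivrMr//; apply/andP; split; nra.
- move=> i /nN/level[q1' [? [? [/jE E _ wE]]]].
  by move: wE; rewrite opprK /j -E addrA subrr add0r.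
Qed.

Lemma solenoid_close_le (m n : nat) (s s' : R) : (m <= n)%N ->
  solenoid_close n s s' -> solenoid_close m s s'.
Proof.
move=> mn [z zn]; exists (2 ^+ (n - m) * z).
rewrite intrM rmorphXn /= mulrA -exprD subnKC//; apply: (le_trans zn).
by rewrite lef_pV2 ?posrE ?exprn_gt0// ler_weXn2l// ler1n.
Qed.

Lemma window_eq_le (m n : nat) (C : Type) (w w' : int -> C) : (m <= n)%N ->
  window_eq n w w' -> window_eq m w w'.
Proof. by move=> mn ww' k km; apply: ww'; lia. Qed.

Lemma window_eq_sym (n : nat) (C : Type) (w w' : int -> C) :
  window_eq n w w' -> window_eq n w' w.
Proof. by move=> ww' k /ww' ->. Qed.

Lemma window_eq_trans (n : nat) (C : Type) (w1 w2 w3 : int -> C) :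
  window_eq n w1 w2 -> window_eq n w2 w3 -> window_eq n w1 w3.
Proof. by move=> w12 w23 k kn; rewrite w12// w23. Qed.

Lemma pow2V_lt (e : R) : 0 < e -> exists n : nat, (2 ^+ n)^-1 < e.
Proof.
move=> e0; exists (Num.bound e^-1); rewrite invf_plt ?posrE ?exprn_gt0//.
apply: lt_trans (archi_boundP _) _; first by rewrite invr_ge0 ltW.
by rewrite -natrX ltr_nat; exact: ltn_expl.
Qed.

Lemma delta_penrose (e : R) : 0 < e -> exists n : nat,
  forall (C : Type) (w w' : int -> C) (s s' : R),
  solenoid_close n s s' -> window_eq n w w' ->
  delta (tiling_act (translation s) (penrose R w))
    (tiling_act (translation s') (penrose R w')) < e.
Proof.
move=> e0; have e2 : 0 < e / 2 by rewrite divr_gt0.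
have [n nP] := penrose_agree e2; exists n => C w w' s s' ss' ww'.
apply: (@le_lt_trans _ _ (e / 2)); last by lra.
exact/agree_delta/nP.
Qed.

Lemma delta_penrose_inv (n : nat) : exists2 e : R, 0 < e &
  forall (C : Type) (w w' : int -> C) (t t' s s' : R) (t0 : 0 < t) (t0' : 0 < t'),
  1/2 <= t <= 2 ->
  delta (tiling_act (aff_mul (dilation t0) (translation s)) (penrose R w))
    (tiling_act (aff_mul (dilation t0') (translation s')) (penrose R w')) < e ->
  exists j : int, [/\ `|t' * 2 ^ (- j) - t| <= (2 ^+ n)^-1,
    solenoid_close n s (2 ^ j * s') & window_eq n w (fun k => w' (k + j))].
Proof.
have [e e0 eP] := agree_penrose_inv n.
pose f := Num.min e (Num.sqrt 2)^-1.
have f0 : 0 < f by rewrite lt_min e0 invr_gt0 sqrtr_gt0 ltr0n.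
exists f => // C w w' t t' s s' t0 t0' t12 tf; apply: (eP _ _ _ _ _ _ _ t0 t0' t12).
apply: (agree_le f0); first by rewrite ge_min lexx.
by apply: delta_agree => //; rewrite ge_min lexx orbT.
Qed.

(** A nonzero j makes b 2^(-j) at least 7/4 or at most 9/16, both further than 1/8 from
    [7/8, 9/8]. *)
Lemma pow2_near_one (a b : R) (j : int) : 7/8 <= a <= 9/8 -> 7/8 <= b <= 9/8 ->
  `|b * 2 ^ (- j) - a| <= 1/8 -> j = 0.
Proof.
move=> /andP[a1 a2] /andP[b1 b2]; rewrite ler_norml => /andP[j1 j2].
have [j_lt|j_gt|//] := ltgtP j 0; exfalso.
  have : (2 : R) ^ 1 <= 2 ^ (- j) by rewrite pow2_mono; lia.
  rewrite expr1z; move: (2 ^ (- j)) j1 j2 => X j1 j2 X2; nra.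
have : (2 : R) ^ (- j) <= 2 ^ (-1) by rewrite pow2_mono; lia.
rewrite (_ : (2 : R) ^ (-1) = 2^-1)//; move: (2 ^ (- j)) j1 j2 => X j1 j2 X2; nra.
Qed.

Lemma delta_penrose_inv1 (n : nat) : exists2 e : R, 0 < e &
  forall (C : Type) (w w' : int -> C) (t t' s s' : R) (t0 : 0 < t) (t0' : 0 < t'),
  7/8 <= t <= 9/8 -> 7/8 <= t' <= 9/8 ->
  delta (tiling_act (aff_mul (dilation t0) (translation s)) (penrose R w))
    (tiling_act (aff_mul (dilation t0') (translation s')) (penrose R w')) < e ->
  [/\ `|t' - t| <= (2 ^+ n)^-1, solenoid_close n s s' & window_eq n w w'].
Proof.
(* 2^(-3) is the error 1/8 allowed by [pow2_near_one]. *)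
have [e e0 eP] := delta_penrose_inv (maxn n 3); exists e => //.
move=> C w w' t t' s s' t0 t0' tb tb' te.
have t12 : 1/2 <= t <= 2 by lra.
have [j [jt js jw]] := eP _ _ _ _ _ _ _ _ _ t12 te.
have le (i : nat) : (i <= maxn n 3)%N -> (2 ^+ maxn n 3)^-1 <= (2 ^+ i)^-1 :> R.
  by move=> im; rewrite lef_pV2 ?posrE ?exprn_gt0// ler_weXn2l// ler1n.
have j0 : j = 0.
  apply: (pow2_near_one tb tb'); apply: (le_trans jt).
  by apply: le_trans (le 3 (leq_maxr _ _)) _; lra.
move: jt js jw; rewrite j0 oppr0 expr0z mulr1 mul1r => jt js jw; split.
- by apply: (le_trans jt); apply: le; rewrite leq_maxl.
- by apply: solenoid_close_le js; rewrite leq_maxl.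
- apply: (@window_eq_le _ (maxn n 3)); first by rewrite leq_maxl.
  by move=> k /jw ->; rewrite addr0.
Qed.

Lemma dilation1 : dilation (ltr01 : 0 < 1 :> R) = aff1 R.
Proof. exact: aff_eq. Qed.

(** Colours are constant on levels, so the closeness of s and s' in the solenoid, read off the
    uncoloured tilings, serves for any colouring. *)
Lemma delta_recolor (e : R) : 0 < e -> exists d n, 0 < d /\
  forall (C : Type) (w w' : int -> C) (s s' : R),
  delta (tiling_act (translation s) (penrose0 R))
    (tiling_act (translation s') (penrose0 R)) < d ->
  window_eq n w w' ->
  delta (tiling_act (translation s) (penrose R w))
    (tiling_act (translation s') (penrose R w')) < e.
Proof.
move=> /delta_penrose[n nP]; have [d d0 dP] := delta_penrose_inv1 n.
exists d, n; split=> // C w w' s s' ss' ww'; apply: nP => //.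
have one : 7/8 <= (1 : R) <= 9/8 by lra.
have := dP unit (fun=> tt) (fun=> tt) 1 1 s s' ltr01 ltr01 one one.
by rewrite dilation1 !aff_mul1g => /(_ ss')[].
Qed.

End Penrose.

(** * Distance and topology of a completion *)

Section Completion.
Variables (R : realType) (X : quasimetric R).
Implicit Types (u v : cauchy_sequence X) (x y z : completion X).

(** [cdist] is defined on chosen representatives; this frees it from the choice. *)
Lemma cdist_cvg u v :
  (fun n => qdist (u n) (v n)) @ \oo --> cdist (cclass u) (cclass v).
Proof.
suff H (u1 v1 u2 v2 : cauchy_sequence X) : cclass u1 = cclass u2 -> cclass v1 = cclass v2 ->
    lim ((fun n => qdist (u1 n) (v1 n)) @ \oo) <= lim ((fun n => qdist (u2 n) (v2 n)) @ \oo).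
  have -> : cdist (cclass u) (cclass v) = lim ((fun n => qdist (u n) (v n)) @ \oo).
    by apply/eqP; rewrite eq_le !H ?creprK.
  exact: qdist_cvg.
move=> /cclassP/cauchy_equivP uE /esym/cclassP/cauchy_equivP vE.
apply/ler_addgt0Pr => d d0; apply: limr_le; first exact: qdist_cvg.
have d3 : 0 < d / 3 by rewrite divr_gt0.
near=> n.
have : qdist (u2 n) (v2 n) < lim ((fun n => qdist (u2 n) (v2 n)) @ \oo) + d / 3.
  by near: n; apply: (cvgr_lt _ (@qdist_cvg _ _ u2 v2)); rewrite ltrDl.
have : qdist (u1 n) (u2 n) < d / 3 by near: n; exact: uE.
have : qdist (v2 n) (v1 n) < d / 3 by near: n; exact: vE.
have := qdist_tri (u2 n) (u1 n) (v1 n); have := qdist_tri (v2 n) (u2 n) (v1 n).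
lra.
Unshelve. all: by end_near. Qed.

Lemma cdist_cembed (a b : X) : cdist (cembed a) (cembed b) = qdist a b.
Proof.
have H : (fun _ : nat => qdist a b) @ \oo --> cdist (cembed a) (cembed b).
  exact: cdist_cvg.
by rewrite -(cvg_lim (@norm_hausdorff _ _) H) (lim_cst (@norm_hausdorff _ _)).
Qed.

Lemma cdistxx x : cdist x x = 0.
Proof.
rewrite /cdist; under eq_fun do rewrite qdistxx.
by rewrite (lim_cst (@norm_hausdorff _ _)).
Qed.

Lemma cdist_tri y x z : cdist x z <= cdist x y + cdist y z.
Proof.
rewrite /cdist -limD; [|exact: qdist_cvg..].
apply: ler_lim; [exact: qdist_cvg|apply: is_cvgD; exact: qdist_cvg|].
by apply: nearW => n; exact: qdist_tri.
Qed.

Lemma cdist_lt_add y x z (a b : R) :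
  cdist x y < a -> cdist y z < b -> cdist x z < a + b.
Proof.
by move=> xy yz; apply: le_lt_trans (cdist_tri y x z) _; exact: ltrD.
Qed.

Lemma cdist_lt_split y x z (e : R) :
  cdist x y < e / 2 -> cdist y z < e / 2 -> cdist x z < e.
Proof. by move=> xy yz; rewrite (splitr e); exact: cdist_lt_add xy yz. Qed.

Lemma cdist_lt_split3 y y' x z (e : R) :
  cdist x y < e / 3 -> cdist y y' < e / 3 -> cdist y' z < e / 3 -> cdist x z < e.
Proof.
move=> xy yy' y'z; have -> : e = e / 3 + (e / 3 + e / 3) by field.
exact: cdist_lt_add xy (cdist_lt_add yy' y'z).
Qed.

Lemma cdist_sym (e : R) : 0 < e -> exists2 f, 0 < f &
  forall x y, cdist x y < f -> cdist y x < e.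
Proof.
move=> e0; have e2 : 0 < e / 2 by rewrite divr_gt0.
have [f f0 fP] := qdist_sym X e2.
exists f => // x y /cdist_lt xy; apply: (@le_lt_trans _ _ (e / 2)); last by lra.
rewrite -[x]creprK -[y]creprK; apply: cdist_le.
by near=> n; apply/ltW/fP; near: n.
Unshelve. all: by end_near. Qed.

Lemma cdist_eq x y : (forall e, 0 < e -> cdist x y < e) -> x = y.
Proof.
move=> xy; rewrite -[x]creprK -[y]creprK; apply/cclassP/cauchy_equivP => e e0.
exact/cdist_lt/xy.
Qed.

Lemma cseq_cvg u (e : R) : 0 < e ->
  exists N, forall n, (N <= n)%N -> cdist (cclass u) (cembed (u n)) < e.
Proof.
move=> e0; have e2 : 0 < e / 2 by rewrite divr_gt0.
have [N uN] := cseqP u e2; exists N => n Nn.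
apply: (@le_lt_trans _ _ (e / 2)); last by lra.
by apply: cdist_le; exists N => // m Nm; apply/ltW/uN.
Qed.

Lemma nbhs_completionP x (U : set (completion X)) :
  nbhs x U <-> exists2 e, 0 < e & forall y, cdist x y < e -> U y.
Proof.
split=> [|[e e0 eU]].
  rewrite nbhsE => -[V [oV Vx] VU]; move: oV; rewrite completion_openE.
  by move=> /(_ _ Vx)[e e0 eV]; exists e => // y /eV/VU.
rewrite nbhsE; exists [set y | cdist x y < e] => //; split; last by rewrite /= cdistxx.
rewrite completion_openE => y /= xy; exists (e - cdist x y); first by lra.
by move=> z yz; have := cdist_tri y x z; lra.
Qed.

End Completion.

Lemma cmap_uniform (R : realType) (X Y : quasimetric R) (f : X -> Y) (uf : uniform_map f)
  (e : R) : 0 < e -> exists2 d, 0 < d &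
  forall x y, cdist x y < d -> cdist (cmap uf x) (cmap uf y) < e.
Proof.
move=> e0; have e2 : 0 < e / 2 by rewrite divr_gt0.
have [d d0 dP] := uf _ e2.
exists d => // x y /cdist_lt xy; apply: (@le_lt_trans _ _ (e / 2)); last by lra.
by apply: cdist_le; near=> n; apply/ltW/dP; near: n.
Unshelve. all: by end_near. Qed.

(** * Neighbourhoods in the presuspension *)

Lemma nbhs_set_typeP (T : topologicalType) (A : set T) (x : A) (U : set A) :
  nbhs x U <-> exists2 V, nbhs (set_val x) V & forall y : A, V (set_val y) -> U y.
Proof.
split=> [[_ [[B oB <-] Bx] BU]|[V xV VU]].
  by exists B; [exact: open_nbhs_nbhs|move=> y; exact: BU].
exists (set_val @^-1` V°); split => //; last by move=> y /interior_subset/VU.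
by exists V° => //; exact: open_interior.
Qed.

Lemma nbhs_configP (r : nat) (v : config r) (U : set (config r)) :
  nbhs v U <-> exists n, forall v' : config r, @window_eq n 'I_r v v' -> U v'.
Proof.
split=> [|[n nU]].
  pose F : set_system (config r) :=
    filter_from setT (fun n v' => @window_eq n 'I_r v v').
  have FF : Filter F.
    apply: filter_from_filter; first by exists 0%N.
    move=> i j _ _; exists (maxn i j) => // v' vv'.
    by split; apply: (@window_eq_le _ (maxn i j)); rewrite ?leq_maxl ?leq_maxr.
  suff Fv : F --> v by move=> /Fv[n _ nU]; exists n => v'; exact: nU.
  apply/cvg_sup => k A; rewrite nbhsE => -[_ [[B oB <-] Bv] BA].
  exists `|k|%N => // v' vv'; apply: BA => /=.
  by rewrite -[v' k](vv' k)//; lia.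
have H (k : int) : nbhs v [set v' : config r | v k = v' k].
  have := @proj_continuous int (fun=> discrete_topology 'I_r) k v [set a | v k = a].
  by apply; rewrite nbhs_principalE.
(* The window is indexed by a finite type of 2 n + 1 elements, so that it becomes a finite
   intersection of cylinders. *)
have : nbhs v [set v' : config r | forall i : 'I_(n + n).+1,
    v (i%:Z - n%:Z) = v' (i%:Z - n%:Z)].
  apply: (@filter_forall (config r) _
    (fun (i : 'I_(n + n).+1) v' => v (i%:Z - n%:Z) = v' (i%:Z - n%:Z)) (nbhs v) _).
  by move=> i; exact: H.
apply: filterS => v' vv'; apply: nU => k kn.
have kb : (absz (k + n%:Z)%R < (n + n).+1)%N by lia.
have := vv' (Ordinal kb) => /=.
by have -> : (absz (k + n%:Z)%R)%:Z - n%:Z = k by lia.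
Qed.

Lemma nbhs_presuspensionP (R : realType) (r : nat) (w : config r)
    (T : @N_hull R) (v : subshift w) (t : @posreals R) (U : set (presuspension R w)) :
  nbhs ((T, v, t) : presuspension R w) U <-> exists (e : R) n, 0 < e /\
    forall T' (v' : subshift w) t', cdist (set_val T) (set_val T') < e ->
    @window_eq n 'I_r (set_val v) (set_val v') ->
    `|set_val t' - set_val t| < e -> U (T', v', t').
Proof.
split=> [[[A B] /= [[[A1 B1] /= [A1T B1v] AB1] Bt] AB]|[e [n [e0 enU]]]].
  have [A2 /nbhs_completionP[e1 e10 e1P] A2P] := (nbhs_set_typeP _ _).1 A1T.
  have [B2 /nbhs_configP[n nP] B2P] := (nbhs_set_typeP _ _).1 B1v.
  have [C2 /nbhs_ballP[e2 /= e20 e2P] C2P] := (nbhs_set_typeP _ _).1 Bt.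
  exists (Num.min e1 e2), n; split; first by rewrite lt_min e10.
  move=> T' v' t'; rewrite !lt_min => /andP[T1 _] vv /andP[_ t2].
  apply: AB; split; last by apply: C2P; apply: e2P; rewrite /ball /= distrC.
  by apply: AB1; split; [apply/A2P/e1P|apply/B2P/nP].
pose A1 := [set T' : @N_hull R | cdist (set_val T) (set_val T') < e].
pose B1 := [set v' : subshift w | @window_eq n 'I_r (set_val v) (set_val v')].
pose B := [set t' : @posreals R | `|set_val t' - set_val t| < e].
exists (A1 `*` B1, B) => /=; last by move=> [[T' v'] t'] [[/= ? ?] ?]; exact: enU.
split; last first.
  apply/nbhs_set_typeP; exists (ball (set_val t) e); first exact: nbhsx_ballx.
  by move=> t'; rewrite /ball /= distrC.
exists (A1, B1) => //; split => /=.
  apply/nbhs_set_typeP; exists [set y | cdist (set_val T) y < e] => //.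
  by apply/nbhs_completionP; exists e.
apply/nbhs_set_typeP; exists [set v' : config r | @window_eq n 'I_r (set_val v) v'] => //.
by apply/nbhs_configP; exists n.
Qed.

(** * Distances between points of a hull *)

Section HullPoints.
Variables (R : realType) (C : Type) (T0 : @tiling R C).

Lemma cdist_hull_pt (g h : aff R) : cdist (hull_pt T0 g) (hull_pt T0 h) =
  delta (tiling_act g T0) (tiling_act h T0).
Proof. exact: cdist_cembed. Qed.

Lemma delta_aff_norm (g : aff R) (T : @tiling R C) : delta T (tiling_act g T) <= aff_norm g.
Proof.
apply/ler_addgt0Pr => e e0; have g0 := aff_norm_ge0 g.
apply: agree_delta; first by lra.
by exists g; split; [lra|].
Qed.

Lemma cdist_hull_act (g : aff R) (x : hull T0) : cdist x (hull_act g x) <= aff_norm g.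
Proof.
rewrite -[x]creprK /hull_act cmapE; apply: cdist_le.
by apply: nearW => n; exact: delta_aff_norm.
Qed.

Lemma hull_act_uniform (g : aff R) (e : R) : 0 < e -> exists2 d, 0 < d &
  forall x y : hull T0, cdist x y < d -> cdist (hull_act g x) (hull_act g y) < e.
Proof. exact: cmap_uniform. Qed.

Lemma hull_ptP (x : hull T0) (e : R) : 0 < e -> exists g, cdist x (hull_pt T0 g) < e.
Proof.
rewrite -[x]creprK => /(cseq_cvg (repr x))[N /(_ N (leqnn N))].
move: (repr x N) => y xy; have [g _ gE] := set_mem (valP y).
exists g; rewrite (_ : hull_pt T0 g = cembed y)//.
by rewrite /hull_pt /hull_embed; congr cembed; exact: val_inj.
Qed.

End HullPoints.

(** * The limit tiling attached to T and v *)

Section Theta.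
Variables (R : realType) (r : nat) (w : config r).
Implicit Types (T : @N_hull R) (v : subshift w) (t : @posreals R).

Notation pt0 s := (hull_pt (penrose0 R) (translation s)).
Notation P := (penrose R (w : int -> 'I_r)).
Notation shifted m := (fun k : int => (w : int -> 'I_r) (k + m)).

(** By [penrose_pow2] this is P(sigma^m w) + s, written as a point of the orbit of P(w) so that it
    lies in the hull of P(w). *)
Definition orbit_pt (s : R) (m : int) : hull P :=
  hull_pt _ (aff_mul (translation s) (pow2_dilation R m)).

Lemma tiling_act_pow2 (g : aff R) (m : int) :
  tiling_act (aff_mul g (pow2_dilation R m)) P =
  tiling_act g (penrose R (shifted m)).
Proof. by rewrite tiling_actM penrose_pow2. Qed.

Lemma N_hull_approx T (e : R) : 0 < e -> exists s, cdist (set_val T) (pt0 s) < e.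
Proof.
move=> e0; have := set_mem (valP T) => cT.
have [|_ [[s _ <-] sT]] := cT [set y | cdist (set_val T) y < e].
  by apply/nbhs_completionP; exists e.
by exists s.
Qed.

Lemma subshift_approx v (n : nat) :
  exists m, @window_eq n 'I_r (set_val v) (shifted m).
Proof.
have := set_mem (valP v) => cv.
have [|_ [[m _ <-] vm]] := cv [set v' : config r | @window_eq n 'I_r (set_val v) v'].
  by apply/nbhs_configP; exists n.
by exists m.
Qed.

Lemma orbit_pt_close (e : R) : 0 < e -> exists d n, 0 < d /\
  forall (x : hull (penrose0 R)) (v : int -> 'I_r) (s s' : R) (m m' : int),
  cdist x (pt0 s) < d -> cdist x (pt0 s') < d ->
  window_eq n v (shifted m) -> window_eq n v (shifted m') ->
  cdist (orbit_pt s m) (orbit_pt s' m') < e.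
Proof.
move=> /delta_recolor[d [n [d0 dP]]].
have d2 : 0 < d / 2 by rewrite divr_gt0.
have [f f0 fP] := cdist_sym (orbit_quasimetric (penrose0 R)) d2.
exists (Num.min f (d / 2)), n; split; first by rewrite lt_min f0.
move=> x v s s' m m'; rewrite !lt_min => /andP[/fP xs _] /andP[_ xs'] vm vm'.
rewrite cdist_hull_pt !tiling_act_pow2; apply: dP.
  by rewrite -cdist_hull_pt; exact: cdist_lt_split xs xs'.
exact: window_eq_trans (window_eq_sym vm) vm'.
Qed.

(* [x] is the limit of [orbit_pt s m] as s + P -> T and sigma^m w -> v; the
   Cauchy modulus is a premise so that it can later be chosen independently of
   T and v. *)
Lemma theta1_subproof T v : exists x : hull P,
  forall (e d : R) (n : nat), 0 < d ->
  (forall s s' m m', cdist (set_val T) (pt0 s) < d -> cdist (set_val T) (pt0 s') < d ->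
    @window_eq n 'I_r (set_val v) (shifted m) ->
    @window_eq n 'I_r (set_val v) (shifted m') ->
    cdist (orbit_pt s m) (orbit_pt s' m') < e) ->
  forall s m, cdist (set_val T) (pt0 s) < d ->
    @window_eq n 'I_r (set_val v) (shifted m) -> cdist x (orbit_pt s m) <= e.
Proof.
have /choice[u uP] n : exists sm : R * int, cdist (set_val T) (pt0 sm.1) < (2 ^+ n)^-1 /\
    @window_eq n 'I_r (set_val v) (shifted sm.2).
  have n0 : 0 < (2 ^+ n)^-1 :> R by rewrite invr_gt0 exprn_gt0.
  have [s sP] := N_hull_approx T n0; have [m mP] := subshift_approx v n.
  by exists (s, m).
have uE (d : R) (n : nat) : 0 < d -> exists N, forall i, (N <= i)%N ->
    cdist (set_val T) (pt0 (u i).1) < d /\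
    @window_eq n 'I_r (set_val v) (shifted (u i).2).
  move=> /pow2V_lt[k kd]; exists (maxn k n) => i; rewrite geq_max => /andP[ki ni].
  have [uT uv] := uP i; split; last exact: window_eq_le uv.
  apply: (lt_trans uT); apply: le_lt_trans kd.
  by rewrite lef_pV2 ?posrE ?exprn_gt0// ler_weXn2l// ler1n.
pose useq n : orbit_quasimetric P :=
  G_orbit_pt _ (aff_mul (translation (u n).1) (pow2_dilation R (u n).2)).
have uC : is_cauchy useq.
  move=> e /orbit_pt_close[d [n [d0 dP]]]; have [N NP] := uE d n d0.
  exists N => i j /NP[? ?] /NP[? ?]; rewrite -(cdist_cembed (useq i) (useq j)).
  exact: (dP (set_val T) (set_val v)).
exists (cclass (CauchySequence uC)) => e d n d0 H s m Ts vm.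
have [N NP] := uE d n d0.
apply: cdist_le; exists N => // i /NP[Ti vi].
by have /ltW := H _ _ _ _ Ti Ts vi vm; rewrite cdist_hull_pt.
Qed.

Definition theta1 T v := projT1 (cid (theta1_subproof T v)).

(** The modulus depends on e alone, as it is taken from [orbit_pt_close]. *)
Lemma theta1_close (e : R) : 0 < e -> exists d n, 0 < d /\
  forall T v s m, cdist (set_val T) (pt0 s) < d ->
    @window_eq n 'I_r (set_val v) (shifted m) -> cdist (theta1 T v) (orbit_pt s m) < e.
Proof.
move=> e0; have e2 : 0 < e / 2 by rewrite divr_gt0.
have [d [n [d0 dP]]] := orbit_pt_close e2.
exists d, n; split=> // T v s m Ts vm; apply: (@le_lt_trans _ _ (e / 2)); last by lra.
rewrite /theta1; case: cid => x /= xP; apply: (xP _ d n) => //.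
by move=> *; exact: (dP (set_val T) (set_val v)).
Qed.

Lemma theta1_eq T v x :
  (forall e d n, 0 < e -> 0 < d -> exists s m, [/\ cdist (set_val T) (pt0 s) < d,
    @window_eq n 'I_r (set_val v) (shifted m) & cdist (orbit_pt s m) x < e]) ->
  theta1 T v = x.
Proof.
move=> H; apply: cdist_eq => e e0; have e2 : 0 < e / 2 by rewrite divr_gt0.
have [d [n [d0 dP]]] := theta1_close e2; have [s [m [Ts vm smx]]] := H _ d n e2 d0.
exact: cdist_lt_split (dP _ _ _ _ Ts vm) smx.
Qed.

(** Closeness is supplied in both directions because [cdist] is symmetric only up to a change of
    constants. *)
Lemma theta1_approx T v (e d : R) (n : nat) : 0 < e -> 0 < d -> exists s m,
  [/\ cdist (set_val T) (pt0 s) < d, cdist (pt0 s) (set_val T) < d,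
    @window_eq n 'I_r (set_val v) (shifted m),
    cdist (theta1 T v) (orbit_pt s m) < e & cdist (orbit_pt s m) (theta1 T v) < e].
Proof.
move=> e0 d0; have [e1 e10 e1P] := cdist_sym (orbit_quasimetric P) e0.
have e20 : 0 < Num.min e e1 by rewrite lt_min e0.
have [d1 [n1 [d10 d1P]]] := theta1_close e20.
have [d2 d20 d2P] := cdist_sym (orbit_quasimetric (penrose0 R)) d0.
have d30 : 0 < Num.min (Num.min d d1) d2 by rewrite !lt_min d0 d10.
have [s] := N_hull_approx T d30; rewrite !lt_min => /andP[/andP[sd sd1] sd2].
have [m mP] := subshift_approx v (maxn n n1).
have := d1P _ v _ m sd1 (window_eq_le (leq_maxr _ _) mP); rewrite lt_min => /andP[se se1].
exists s, m; split; [exact: sd|exact: d2P| |exact: se|exact: e1P].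
exact: window_eq_le (leq_maxl _ _) mP.
Qed.

Lemma theta1_translate (t : R) T v :
  theta1 (N_translate t T) v = hull_act (translation t) (theta1 T v).
Proof.
apply: theta1_eq => e d n e0 d0.
have [e1 e10 e1P] := hull_act_uniform P (translation t) e0.
have [d1 d10 d1P] := hull_act_uniform (penrose0 R) (translation t) d0.
have [s [m [Ts _ vm _ sm]]] := theta1_approx T v n e10 d10.
exists (s + t), m; split => //.
- rewrite (_ : pt0 (s + t) = hull_act (translation t) (pt0 s)); first exact: d1P.
  by rewrite hull_act_pt; congr hull_pt; apply: aff_eq => /=; ring.
- rewrite (_ : orbit_pt (s + t) m = hull_act (translation t) (orbit_pt s m)).
    exact: e1P.
  by rewrite hull_act_pt; congr hull_pt; apply: aff_eq => /=; ring.
Qed.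

Lemma theta1_R T v :
  theta1 (N_R T) (subshift_shift 1 v) = hull_act (affR R) (theta1 T v).
Proof.
apply: theta1_eq => e d n e0 d0.
have [e1 e10 e1P] := hull_act_uniform P (affR R) e0.
have [d1 d10 d1P] := hull_act_uniform (penrose0 R) (affR R) d0.
(* The shift moves the window by one, hence [n.+1]. R turns the translation by s into the one by 2
   s, fixes the uncoloured tiling and shifts w. *)
have [s [m [Ts _ vm _ sm]]] := theta1_approx T v n.+1 e10 d10.
exists (2 * s), (1 + m); split => //.
- move: (d1P _ _ Ts); rewrite hull_act_pt.
  rewrite (_ : aff_mul _ _ = aff_mul (translation (2 * s)) (affR R)) ?affR_penrose0//.
  by apply: aff_eq => /=; ring.
- move=> k kn; rewrite addrA; apply: vm; lia.
- rewrite (_ : orbit_pt (2 * s) (1 + m) = hull_act (affR R) (orbit_pt s m)).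
    exact: e1P.
  rewrite hull_act_pt; congr hull_pt.
  by apply: aff_eq; rewrite /= ?pow2D ?expr1z; ring.
Qed.

Lemma theta1_base : theta1 (N_base R) (subshift_base w) = hull_pt _ (aff1 R).
Proof.
apply: theta1_eq => e d n e0 d0; exists 0, 0; split.
- by rewrite (_ : pt0 0 = hull_pt _ (aff1 R)) ?cdistxx//; congr hull_pt; exact: aff_eq.
- by move=> k _; rewrite addr0.
- rewrite (_ : orbit_pt 0 0 = hull_pt _ (aff1 R)) ?cdistxx//.
  by congr hull_pt; apply: aff_eq => /=; rewrite ?expr0z; ring.
Qed.

(** * The map [theta] on the presuspension: equivariance and continuity *)

Implicit Types p q : presuspension R w.

Lemma posreals_gt0 t : 0 < set_val t.
Proof. exact: set_mem (valP t). Qed.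

Lemma posreals_mulE (a : R) (a0 : 0 < a) t : set_val (posreals_mul a0 t) = a * set_val t.
Proof. by []. Qed.

Definition theta p : hull P :=
  let: (T, v, t) := p in hull_act (dilation (posreals_gt0 t)) (theta1 T v).

(** For g with scale a and translation b, g after the dilation by t is the dilation by a t after the
    translation by b / (a t): this is the origin of the formula for the action. *)
Lemma theta_act (g : aff R) p : theta (presuspension_act g p) = hull_act g (theta p).
Proof.
case: p => [[T v] t]; rewrite /theta /presuspension_act theta1_translate -!hull_actM.
congr hull_act; have t0 := posreals_gt0 t; have g0 := scale_gt0 g.
apply: aff_eq; rewrite [LHS]/= [RHS]/= posreals_mulE; first by ring.
by field; rewrite !gt_eqF.
Qed.

Lemma theta_base : theta (presuspension_base R w) = hull_pt _ (aff1 R).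
Proof.
rewrite /= theta1_base (_ : dilation _ = aff1 R) ?hull_act1//.
by apply: aff_eq => /=.
Qed.

Lemma theta_map p : theta (suspension_map p) = theta p.
Proof.
case: p => [[T v] t]; rewrite /theta /suspension_map theta1_R -hull_actM.
by congr hull_act; apply: aff_eq; rewrite [LHS]/= [RHS]/= ?posreals_mulE; field.
Qed.

Lemma theta_orbit p q : same_orbit p q -> theta p = theta q.
Proof.
have H n x : theta (iter n (@suspension_map R r w) x) = theta x.
  by elim: n => //= n <-; exact: theta_map.
by move=> /asboolP[n [] <-]; rewrite H.
Qed.

Lemma theta1_uniform (e : R) : 0 < e -> exists d n, 0 < d /\
  forall T v T' v', cdist (set_val T) (set_val T') < d ->
    @window_eq n 'I_r (set_val v) (set_val v') ->
    cdist (theta1 T v) (theta1 T' v') < e.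
Proof.
move=> e0; have e2 : 0 < e / 2 by rewrite divr_gt0.
have [d [n [d0 dP]]] := theta1_close e2.
have d2 : 0 < d / 2 by rewrite divr_gt0.
exists (d / 2), n; split=> // T v T' v' TT vv.
have [s [m [Ts _ vm _ sm]]] := theta1_approx T' v' n e2 d2.
have sT : cdist (set_val T) (pt0 s) < d := cdist_lt_split TT Ts.
exact: cdist_lt_split (dP _ _ _ _ sT (window_eq_trans vv vm)) sm.
Qed.

(** The pair (T, v) is changed first, under the fixed dilation by t; the dilation by t' / t that
    remains has small norm. *)
Lemma theta_continuous : continuous theta.
Proof.
move=> [[T v] t] U /nbhs_completionP[e e0 eU]; apply/nbhs_presuspensionP.
have e2 : 0 < e / 2 by rewrite divr_gt0.
have [e1 e10 e1P] := hull_act_uniform P (dilation (posreals_gt0 t)) e2.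
have [d [n [d0 dP]]] := theta1_uniform e10.
have [f f0 fP] := aff_norm_lt e2; have t0 := posreals_gt0 t.
have ft0 : 0 < f * set_val t by rewrite mulr_gt0.
exists (Num.min d (f * set_val t)), n; split; first by rewrite lt_min d0.
move=> T' v' t'; rewrite !lt_min => /andP[TT _] vv /andP[_ tt]; apply: eU => /=.
have t0' := posreals_gt0 t'.
have a0 : 0 < set_val t' / set_val t by rewrite divr_gt0.
have -> : dilation (posreals_gt0 t') =
    aff_mul (dilation a0) (dilation (posreals_gt0 t)).
  by apply: aff_eq => /=; field; rewrite ?gt_eqF.
rewrite hull_actM; apply: cdist_lt_split (e1P _ _ (dP _ _ _ _ TT vv)) _.
apply: le_lt_trans (cdist_hull_act _ _) _; apply: fP; rewrite /= ?normr0 ?(ltW f0)//.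
have -> : set_val t' / set_val t - 1 = (set_val t' - set_val t) / set_val t.
  by field; rewrite ?gt_eqF.
by rewrite normrM normfV (gtr0_norm t0) ler_pdivrMr// ltW.
Qed.

(** * Injectivity and openness of [theta] modulo orbits *)

Lemma suspension_map_surj p : exists q, suspension_map q = p.
Proof.
case: p => [[T v] t].
exists (N_RV T, subshift_shift (- 1) v, posreals_mul (ltr0Sn R 1) t).
rewrite /= N_RVK; congr (_, _, _).
  by have := subshift_shiftK (- 1) v; rewrite opprK.
by apply: val_inj; rewrite -[LHS]/(2^-1 * (2 * set_val t)) -[RHS]/(set_val t); field.
Qed.

Lemma iter_suspension_map (n : nat) p :
  set_val (iter n (@suspension_map R r w) p).2 = (2 ^+ n)^-1 * set_val p.2.
Proof.
elim: n => [|n IH]; first by rewrite invr1 mul1r.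
rewrite iterS; move: IH; case: (iter n _ p) => [[T v] t] /= IH.
by rewrite set_valE /= -set_valE IH exprS invfM mulrA.
Qed.

Lemma orbit_rescale p (j : int) : exists q, same_orbit q p /\
  set_val q.2 = set_val p.2 * 2 ^ (- j).
Proof.
case: j => n.
  exists (iter n (@suspension_map R r w) p); split.
    by apply/asboolP; exists n; right.
  by rewrite iter_suspension_map mulrC -invr_expz.
have [q qp] : exists q, iter n.+1 (@suspension_map R r w) q = p.
  elim: n.+1 p => [|m IH] p; first by exists p.
  have [q qp] := suspension_map_surj p; have [q' q'q] := IH q.
  by exists q'; rewrite iterS q'q.
exists q; split; first by apply/asboolP; exists n.+1; left.
rewrite -qp iter_suspension_map NegzE opprK mulrAC.
by rewrite -[2 ^ n.+1]/(2 ^+ n.+1) mulVf ?mul1r// gt_eqF// exprn_gt0.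
Qed.

(** Brings a distance in the hull down to actual tilings: the strict inequality leaves the slack e -
    c, half of which pays for each replacement of a limit by an orbit point. *)
Lemma theta1_delta_approx T v T' v' (a : R) (a0 : 0 < a) (e d : R) (n : nat) : 0 < d ->
  cdist (theta1 T v) (hull_act (dilation a0) (theta1 T' v')) < e ->
  exists s m s' m', [/\ cdist (set_val T) (pt0 s) < d, cdist (pt0 s') (set_val T') < d,
    @window_eq n 'I_r (set_val v) (shifted m),
    @window_eq n 'I_r (set_val v') (shifted m') &
    delta (tiling_act (aff_mul (dilation (ltr01 : 0 < 1 :> R)) (translation s))
        (penrose R (shifted m)))
     (tiling_act (aff_mul (dilation a0) (translation s')) (penrose R (shifted m'))) < e].
Proof.
move=> d0; set x := theta1 T v; set y := theta1 T' v' => xy.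
move: {-1}(cdist _ _) (erefl (cdist x (hull_act (dilation a0) y))) xy => c cE ce.
have e0 : 0 < (e - c) / 2 by rewrite divr_gt0// subr_gt0.
have [e1 e10 e1P] := hull_act_uniform P (dilation a0) e0.
have [s [m [Ts _ vm _ sx]]] := theta1_approx T v n e0 d0.
have [s' [m' [_ sT vm' ys _]]] := theta1_approx T' v' n e10 d0.
exists s, m, s', m'; split => //.
rewrite -!tiling_act_pow2 -cdist_hull_pt.
have -> : hull_pt P (aff_mul (aff_mul (dilation (ltr01 : 0 < 1 :> R)) (translation s))
    (pow2_dilation R m)) = orbit_pt s m by rewrite dilation1 aff_mul1g.
have -> : hull_pt P (aff_mul (aff_mul (dilation a0) (translation s')) (pow2_dilation R m')) =
    hull_act (dilation a0) (orbit_pt s' m') by rewrite hull_act_pt aff_mulA.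
have -> : e = (e - c) / 2 + (c + (e - c) / 2) by field.
apply: cdist_lt_add sx _; apply: le_lt_trans (cdist_tri (hull_act (dilation a0) y) _ _) _.
by rewrite cE ltrD2l; exact: e1P ys.
Qed.

Lemma one_near : 7/8 <= (1 : R) <= 9/8. Proof. by lra. Qed.

Lemma theta1_scale : exists2 e : R, 0 < e &
  forall T v T' v' (a : R) (a0 : 0 < a),
  cdist (theta1 T v) (hull_act (dilation a0) (theta1 T' v')) < e ->
  exists j : int, 7/8 <= a * 2 ^ (- j) <= 9/8.
Proof.
(* 2^(-3) = 1/8 is the half-width of [7/8, 9/8]. *)
have [e e0 eP] := delta_penrose_inv R 3; exists e => // T v T' v' a a0.
move=> /(theta1_delta_approx 0 ltr01)[s [m [s' [m' [_ _ _ _ ss]]]]].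
have [|j [jP _ _]] := eP _ _ _ _ _ _ _ _ _ _ ss; first by lra.
by exists j; move: jP; rewrite ler_norml; lra.
Qed.

(** With a in [7/8, 9/8] no power of 2 is left free, so [delta_penrose_inv1] recovers all the data;
    T and T' are compared through the one-colour case of [delta_penrose]. *)
Lemma theta1_inv (d : R) (n : nat) : 0 < d -> exists2 e : R, 0 < e &
  forall T v T' v' (a : R) (a0 : 0 < a), 7/8 <= a <= 9/8 ->
  cdist (theta1 T v) (hull_act (dilation a0) (theta1 T' v')) < e ->
  [/\ `|a - 1| < d, cdist (set_val T) (set_val T') < d &
    @window_eq n 'I_r (set_val v) (set_val v')].
Proof.
move=> d0; have d3 : 0 < d / 3 by rewrite divr_gt0.
have [n1 n1P] := delta_penrose d3; have [n2 n2d] := pow2V_lt d0.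
pose N := maxn n (maxn n1 n2).
have nN : (n <= N)%N by rewrite leq_maxl.
have n1N : (n1 <= N)%N by rewrite /N maxnCA leq_maxl.
have n2N : (n2 <= N)%N by rewrite /N maxnA leq_maxr.
have [e e0 eP] := delta_penrose_inv1 R N; exists e => // T v T' v' a a0 ab.
move=> /(theta1_delta_approx N d3)[s [m [s' [m' [Ts sT vm vm' ss]]]]].
have [aN sN wN] := eP _ _ _ _ _ _ _ _ _ one_near ab ss; split.
- apply: (le_lt_trans aN); apply: le_lt_trans n2d.
  by rewrite lef_pV2 ?posrE ?exprn_gt0// ler_weXn2l// ler1n.
- have := n1P unit (fun=> tt) (fun=> tt) s s' (solenoid_close_le n1N sN) (fun _ _ => erefl).
  rewrite -/(penrose0 R) -cdist_hull_pt => ss'.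
  exact: cdist_lt_split3 Ts ss' sT.
- apply: (window_eq_le nN); apply: window_eq_trans vm _.
  exact: window_eq_trans wN (window_eq_sym vm').
Qed.

Lemma theta_dilation T v t (a : R) (a0 : 0 < a) :
  hull_act (dilation a0) (theta (T, v, t)) = theta (T, v, posreals_mul a0 t).
Proof.
rewrite /= -hull_actM; congr hull_act.
by apply: aff_eq; rewrite /= ?set_valE /= ?mulr0 ?addr0.
Qed.

(** First half of openness: the right representative of the orbit is selected by its scale, before
    any neighbourhood of p is given. *)
Lemma theta_inv p : exists2 e0, 0 < e0 & forall p', cdist (theta p) (theta p') < e0 ->
  exists q, same_orbit q p' /\ 7/8 * set_val p.2 <= set_val q.2 <= 9/8 * set_val p.2.
Proof.
case: p => [[T v] t]; have t0 := posreals_gt0 t.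
have [e e0 eP] := theta1_scale.
have [d d0 dP] := hull_act_uniform P
  (aff_inv (dilation (posreals_gt0 t))) e0.
exists d => // -[[T' v'] t'] /dP /=; have t0' := posreals_gt0 t'.
rewrite -!hull_actM aff_mulVg hull_act1.
have a0 : 0 < set_val t' / set_val t by rewrite divr_gt0.
have -> : aff_mul (aff_inv (dilation (posreals_gt0 t))) (dilation (posreals_gt0 t')) = dilation a0.
  by apply: aff_eq => /=; field; rewrite ?gt_eqF.
move=> /eP[j jP]; have [q [qp qE]] := orbit_rescale (T', v', t') j.
exists q; split=> //=; rewrite qE /=.
by move: jP; rewrite mulrAC ler_pdivlMr// ler_pdivrMr.
Qed.

(** Second half of openness: undoing the dilation by the scale of p reduces it to [theta1_inv]. *)
Lemma theta_inv_near p (U : set (presuspension R w)) : nbhs p U ->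
  exists2 e, 0 < e & forall q, 7/8 * set_val p.2 <= set_val q.2 <= 9/8 * set_val p.2 ->
  cdist (theta p) (theta q) < e -> U q.
Proof.
case: p => [[T v] t] /nbhs_presuspensionP[d [n [d0 dU]]].
have t0 := posreals_gt0 t.
have d10 : 0 < Num.min d (d / set_val t) by rewrite lt_min d0 divr_gt0.
have [e e0 eP] := theta1_inv n d10.
have [f f0 fP] := hull_act_uniform P
  (aff_inv (dilation (posreals_gt0 t))) e0.
exists f => // -[[T' v'] t'] /= /andP[t1 t2] /fP; have t0' := posreals_gt0 t'.
rewrite -!hull_actM aff_mulVg hull_act1.
have a0 : 0 < set_val t' / set_val t by rewrite divr_gt0.
have -> : aff_mul (aff_inv (dilation (posreals_gt0 t))) (dilation (posreals_gt0 t')) = dilation a0.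
  by apply: aff_eq => /=; field; rewrite ?gt_eqF.
move=> /eP[]; first by rewrite ler_pdivlMr// t1 ler_pdivrMr.
rewrite !lt_min => /andP[_ ta] /andP[TT _] vv; apply: dU => //.
have -> : set_val t' - set_val t = (set_val t' / set_val t - 1) * set_val t.
  by field; rewrite ?gt_eqF.
by rewrite normrM (gtr0_norm t0) -ltr_pdivlMr.
Qed.

(** The representative q given by [theta_inv] is fixed once, and then lies in every neighbourhood of
    p; the presuspension is separated, so q is p. *)
Lemma theta_inj p p' : theta p = theta p' -> same_orbit p p'.
Proof.
move=> pp'; have [e e0 /(_ p')] := theta_inv p.
rewrite pp' cdistxx => /(_ e0)[q [qp' qb]].
have {}pp' : theta p = theta q by rewrite pp' (theta_orbit qp').
suff -> : p = q by [].
have near (U : set (presuspension R w)) : nbhs p U -> U q.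
  move=> /theta_inv_near[f f0]; apply => //; by rewrite -pp' cdistxx.
have {}near d n : 0 < d -> cdist (set_val p.1.1) (set_val q.1.1) < d /\
    @window_eq n 'I_r (set_val p.1.2) (set_val q.1.2) /\ `|set_val q.2 - set_val p.2| < d.
  move=> d0; pose U (x : presuspension R w) := cdist (set_val p.1.1) (set_val x.1.1) < d /\
    @window_eq n 'I_r (set_val p.1.2) (set_val x.1.2) /\ `|set_val x.2 - set_val p.2| < d.
  apply: (near U); rewrite {}/U; case: p {pp' qb near} => [[T v] t].
  by apply/nbhs_presuspensionP; exists d, n.
case: p q {qp' qb pp'} near => [[T v] t] [[T' v'] t'] /= near; congr (_, _, _).
- by apply: val_inj; apply: cdist_eq => d /(near d 0%N)[].
- apply: val_inj; apply/funext => k.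
  by have [_ [/(_ k) + _]] := near 1 (absz k) ltr01; apply; lia.
- apply: val_inj; apply/eqP; rewrite eq_sym -subr_eq0 -normr_le0.
  by apply/ler_addgt0Pr => d /(near d 0%N)[_ [_ /ltW]]; rewrite add0r.
Qed.

(** * Surjectivity of [theta] *)

Lemma window_eq_limit (C : Type) (c : nat -> int -> C) :
  (forall K, exists M, forall i j, (M <= i)%N -> (M <= j)%N -> window_eq K (c i) (c j)) ->
  exists v : int -> C, forall K, exists M, forall i, (M <= i)%N -> window_eq K v (c i).
Proof.
(* Coordinate k is constant from index M |k| on; the limit takes that value. *)
move=> /choice[M MP]; exists (fun k => c (M (absz k)) k) => K.
exists (M K) => i iK k kK.
pose j := maxn (M K) (M (absz k)).
rewrite (MP _ _ j (leqnn _) (leq_maxr _ _)); last by lia.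
by apply: (MP K) => //; exact: leq_maxl.
Qed.

(** Since the scales stay in [7/8, 9/8], convergence in the hull makes the three parameters Cauchy
    separately: the scales in the reals, the translates in the uncoloured hull, the shifts of w on
    every window. *)
Lemma theta_limit (x : hull P) (tau sg : nat -> R) (m : nat -> int)
    (tau0 : forall n, 0 < tau n) :
  (forall n, 7/8 <= tau n <= 9/8) ->
  (forall e, 0 < e -> exists N, forall n, (N <= n)%N ->
    cdist x (hull_act (dilation (tau0 n)) (orbit_pt (sg n) (m n))) < e) ->
  exists p, theta p = x.
Proof.
move=> taub xlim.
have close (K : nat) : exists M, forall i j, (M <= i)%N -> (M <= j)%N ->
    [/\ `|tau j - tau i| <= (2 ^+ K)^-1, solenoid_close K (sg i) (sg j) &
      window_eq K (shifted (m i)) (shifted (m j))].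
  have [e e0 eP] := delta_penrose_inv1 R K.
  have e2 : 0 < e / 2 by rewrite divr_gt0.
  have [f f0 fP] := cdist_sym (orbit_quasimetric P) e2.
  have ef0 : 0 < Num.min f (e / 2) by rewrite lt_min f0.
  have [M MP] := xlim _ ef0; exists M => i j /MP + /MP.
  rewrite !lt_min => /andP[/fP xi _] /andP[_ xj].
  apply: (eP _ _ _ _ _ _ _ (tau0 i) (tau0 j)) => //.
  have E n : hull_pt P (aff_mul (aff_mul (dilation (tau0 n)) (translation (sg n)))
      (pow2_dilation R (m n))) = hull_act (dilation (tau0 n)) (orbit_pt (sg n) (m n)).
    by rewrite /orbit_pt hull_act_pt aff_mulA.
  rewrite -!tiling_act_pow2 -cdist_hull_pt !E.
  exact: cdist_lt_split xi xj.
have taucvg : cvg (tau @ \oo).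
  apply/cauchy_cvgP; apply: cauchy_exP => e /pow2V_lt[K Ke].
  have [M MP] := close K; exists (tau M), M => // n /= Mn.
  have [tn _ _] := MP n M Mn (leqnn _).
  by rewrite /ball /=; exact: le_lt_trans tn Ke.
have [t taut] : exists t : R, tau @ \oo --> t by exists (lim (tau @ \oo)).
(* The lower bound keeps the limit scale positive. *)
have t78 : 7/8 <= t.
  apply: (cvgr_to_ge taut); apply: nearW => n; by have /andP[] := taub n.
have t0 : 0 < t by rewrite (lt_le_trans _ t78)// divr_gt0.
pose s0 n : orbit_quasimetric (penrose0 R) := G_orbit_pt _ (translation (sg n)).
have s0C : is_cauchy s0.
  move=> e /delta_penrose[K KP]; have [M MP] := close K; exists M => i j Mi Mj.
  have [_ sij _] := MP i j Mi Mj.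
  by rewrite -(cdist_cembed (s0 i) (s0 j)) cdist_hull_pt; exact: KP.
pose T0 : hull (penrose0 R) := cclass (CauchySequence s0C).
have T0P : T0 \in @N_hull R.
  apply/mem_set => U /nbhs_completionP[e e0 eU].
  have [M /(_ M (leqnn _)) MP] := cseq_cvg (CauchySequence s0C) e0.
  by exists (hull_pt (penrose0 R) (translation (sg M))); split; [exists (sg M)|exact: eU].
have [v vP] : exists v : int -> 'I_r, forall K, exists M, forall i, (M <= i)%N ->
    window_eq K v (shifted (m i)).
  apply: window_eq_limit => K; have [M MP] := close K; exists M => i j Mi Mj.
  by have [] := MP i j Mi Mj.
have vw : (v : config r) \in subshift w.
  apply/mem_set => U /nbhs_configP[K KU]; have [M MP] := vP K.
  by exists (shift_config (m M) w); split; [exists (m M)|apply: KU; exact: MP].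
exists (set_elt T0P, set_elt vw, set_elt (mem_set (t0 : @posreals R t))) => /=.
set D := dilation _; apply/esym/cdist_eq => e e0.
have e3 : 0 < e / 3 by rewrite divr_gt0.
have [e1 e10 e1P] := hull_act_uniform P D e3.
have [f f0 fP] := cdist_sym (orbit_quasimetric P) e10.
have [d [K [d0 dP]]] := theta1_close f0.
have [N1 N1P] := xlim _ e3.
have [N2 N2P] := cseq_cvg (CauchySequence s0C) d0.
have [N3 N3P] := vP K.
have [g g0 gP] := aff_norm_lt e3.
(* As [tau n] is at least 7/8, this gives |t / tau n - 1| <= g. *)
have [N4 _ N4P] : \forall n \near \oo, `|t - tau n| < g * (7/8).
  by move/cvgrPdist_lt: taut; apply; rewrite mulr_gt0//; lra.
pose n := maxn (maxn N1 N2) (maxn N3 N4).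
have [[n1 n2] [n3 n4]] : ((N1 <= n)%N /\ (N2 <= n)%N) /\ ((N3 <= n)%N /\ (N4 <= n)%N).
  by rewrite /n !leq_max !leqnn !orbT.
have a0 : 0 < t / tau n by rewrite divr_gt0.
have DE : D = aff_mul (dilation a0) (dilation (tau0 n)).
  apply: aff_eq; last by rewrite /= ?mulr0 ?addr0.
  by rewrite /= -[LHS]/t; field; rewrite gt_eqF.
have y1 := N1P n n1.
have y2 := fP _ _ (dP (set_elt T0P) (set_elt vw) _ _ (N2P n n2) (N3P n n3)).
have y3 := cdist_hull_act (dilation a0) (hull_act (dilation (tau0 n)) (orbit_pt (sg n) (m n))).
rewrite -hull_actM -DE in y3.
have y4 : aff_norm (dilation a0) < e / 3.
  apply: gP; rewrite /= ?normr0 ?(ltW g0)//.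
  have -> : t / tau n - 1 = (t - tau n) / tau n by field; rewrite gt_eqF.
  rewrite normrM normfV (gtr0_norm (tau0 n)) ler_pdivrMr//.
  have := N4P n n4; have /andP[b1 _] := taub n; move=> /= /ltW h; apply: (le_trans h).
  by rewrite ler_pM2l.
have y5 := e1P _ _ y2.
(* From x to the orbit point dilated by [tau n], to the same point dilated by t, to the value of
   [theta]. *)
exact: cdist_lt_split3 y1 (le_lt_trans y3 y4) y5.
Qed.

Lemma pow2_bracket (a : R) : 0 < a -> exists j : int, 1/2 <= a * 2 ^ (- j) <= 2.
Proof.
move=> a0; have l2 : 0 < ln 2 :> R by rewrite ln_gt0// ltr1n.
have lnE (z : int) : ln (2 ^ z) = z%:~R * ln 2 :> R.
  by rewrite -powR_intmul// ln_powR.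
exists (Num.floor (ln a / ln 2)); set j := Num.floor _.
have /andP[] := floor_itv (ln a / ln 2); rewrite -/j => j1 j2.
have {}j1 : 2 ^ j <= a.
  by rewrite -ler_ln ?posrE ?pow2_gt0// lnE -ler_pdivlMr.
have {}j2 : a <= 2 ^ (j + 1).
  by rewrite -ler_ln ?posrE ?pow2_gt0// lnE -ler_pdivrMr// ltW.
rewrite -invr_expz ler_pdivlMr ?ler_pdivrMr ?pow2_gt0//.
rewrite pow2D expr1z in j2; have p0 := pow2_gt0 R j.
clear lnE l2; move: (2 ^ j) j1 j2 p0 => p j1 j2 p0.
by apply/andP; split; lra.
Qed.

Lemma hull_pt_rescale (g : aff R) (j : int) (a0 : 0 < scale g * 2 ^ (- j)) :
  hull_pt P g = hull_act (dilation a0) (orbit_pt (2 ^ j * (trans g / scale g)) j).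
Proof.
have j0 := pow2_gt0 R j; have g0 := scale_gt0 g.
rewrite hull_act_pt; congr hull_pt.
by apply: aff_eq; rewrite /= -invr_expz; field; rewrite ?gt_eqF.
Qed.

Lemma theta_surj (x : hull P) : exists p, theta p = x.
Proof.
(* The error 2^(-4) is at most t / 8 for the scale t >= 1/2 below, so quotients by t fall in
   [7/8, 9/8]. *)
have [e e0 eP] := delta_penrose_inv R 4.
have e2 : 0 < e / 2 by rewrite divr_gt0.
have [f f0 fP] := cdist_sym (orbit_quasimetric P) e2.
have scaleE (g : aff R) (j : int) : 0 < scale g * 2 ^ (- j).
  by rewrite mulr_gt0 ?scale_gt0 ?pow2_gt0.
have tilingE (g : aff R) (j : int) : tiling_act g P =
    tiling_act (aff_mul (dilation (scaleE g j)) (translation (2 ^ j * (trans g / scale g))))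
      (penrose R (shifted j)).
  rewrite -tiling_act_pow2; congr tiling_act.
  have j0 := pow2_gt0 R j; have g0 := scale_gt0 g.
  by apply: aff_eq; rewrite /= -invr_expz; field; rewrite ?gt_eqF.
have [h xh] := @hull_ptP _ _ P x f f0.
have [k kb] := pow2_bracket (scale_gt0 h).
pose t := scale h * 2 ^ (- k); have t0 : 0 < t := scaleE h k.
(* after dilating by t^-1 all the scales that occur lie in [7/8, 9/8], which
   leaves no freedom for a power of 2 *)
pose V := aff_inv (dilation t0).
have xV : x = hull_act (dilation t0) (hull_act V x).
  by rewrite -hull_actM aff_mulgV hull_act1.
have near (d : R) : 0 < d -> exists tsm : R * R * int, exists tau0 : 0 < tsm.1.1,
    7/8 <= tsm.1.1 <= 9/8 /\
    cdist (hull_act V x) (hull_act (dilation tau0) (orbit_pt tsm.1.2 tsm.2)) < d.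
  move=> d0; have [f1 f10 f1P] := hull_act_uniform P V d0.
  have [|g] := @hull_ptP _ _ P x (Num.min f1 (e / 2)); first by rewrite lt_min f10.
  rewrite lt_min => /andP[/f1P gf ge].
  have : cdist (hull_pt P h) (hull_pt P g) < e := cdist_lt_split (fP _ _ xh) ge.
  (* g enters unscaled; comparison with the fixed h returns the power j that brings its scale near
     t. *)
  rewrite cdist_hull_pt (tilingE h k) (tilingE g 0) => /(eP _ _ _ _ _ _ _ _ _ kb)[j [jb _ _]].
  move: jb; rewrite oppr0 expr0z mulr1 -/t => jb.
  have tau0 : 0 < scale g * 2 ^ (- j) / t by rewrite divr_gt0.
  exists (scale g * 2 ^ (- j) / t, 2 ^ j * (trans g / scale g), j), tau0; split => /=.
    rewrite ler_pdivlMr// ler_pdivrMr//.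
    by move: jb kb; rewrite -/t ler_norml; lra.
  have -> : dilation tau0 = aff_mul V (dilation (scaleE g j)).
    by apply: aff_eq => /=; field; rewrite gt_eqF.
  by rewrite hull_actM -(hull_pt_rescale (scaleE g j)).
have /choice[u uP] n := near (2 ^+ n)^-1 (etrans (invr_gt0 _) (exprn_gt0 n (ltr0Sn R 1))).
have tau0 n : 0 < (u n).1.1 by have [] := uP n.
have [n|d /pow2V_lt[N Nd]|[[T v] s] ps] :=
  @theta_limit (hull_act V x) _ (fun n => (u n).1.2) (fun n => (u n).2) tau0.
- by have [? []] := uP n.
- exists N => n Nn; have [t1 [_ xn]] := uP n.
  rewrite (_ : dilation (tau0 n) = dilation t1); last exact: aff_eq.
  apply: (lt_trans xn); apply: le_lt_trans Nd.
  by rewrite lef_pV2 ?posrE ?exprn_gt0// ler_weXn2l// ler1n.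
- by exists (T, v, posreals_mul t0 s); rewrite -theta_dilation ps -xV.
Qed.

End Theta.

Theorem proposition4p3 (R : realType) (r : nat) (w : int -> 'I_r) :
  (1 < r)%N ->
  exists Psi : G_orbit (penrose R w) -> suspension R w,
    (forall g : aff R, Psi (G_orbit_pt (penrose R w) g) =
       suspension_class (presuspension_act g (presuspension_base R w))) /\
    exists Phi : hull (penrose R w) -> suspension R w,
      (forall x : G_orbit (penrose R w), Phi (hull_embed x) = Psi x) /\
      conjugacy (@hull_act R _ (penrose R w)) (@suspension_act R r w) Phi.
Proof.
(* Any section of [theta] will do: by [theta_inj] the class of [lift x] does not depend on it. *)
move=> _; have /choice[lift liftK] := @theta_surj R r w.
pose Phi x : suspension R w := suspension_class (lift x).
have PhiE p : Phi (theta p) = suspension_class p.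
  by apply/suspension_classP/theta_inj; rewrite liftK.
have Phi_act g x : Phi (hull_act g x) = suspension_act g (Phi x).
  by rewrite -{1}(liftK x) -theta_act PhiE -suspension_actE.
exists (Phi \o @hull_embed _ _ _); split.
  move=> g; rewrite -PhiE theta_act theta_base hull_act_pt aff_mulg1.
  by [].
exists Phi; split=> //; split=> //; split.
  apply/continuousP => U oU; rewrite completion_openE => x Ux.
  have pU : nbhs (lift x) [set p | U (suspension_class p)].
    exact: open_nbhs_nbhs.
  have [e1 e10 e1P] := theta_inv (lift x); have [e2 e20 e2P] := theta_inv_near pU.
  exists (Num.min e1 e2); first by rewrite lt_min e10.
  move=> y; rewrite lt_min -{1 2}(liftK x) -(liftK y) => /andP[y1 y2] /=.
  (* [lift y] may be far from [lift x]; it is replaced by a point q of its orbit, of the same class,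
     that is close. *)
  have [q [qy qb]] := e1P _ y1.
  rewrite PhiE (_ : suspension_class _ = suspension_class q).
    by apply: e2P qb _; rewrite (theta_orbit qy).
  by apply/esym/suspension_classP.
exists (@theta R r w \o repr); split.
- by move=> x; apply: etrans (liftK x); apply/theta_orbit/suspension_classP/reprK.
- by move=> c /=; rewrite PhiE; exact: reprK.
- apply: repr_comp_continuous; first exact: theta_continuous.
  by move=> p q /eqP pq; apply/eqP/theta_orbit/suspension_classP.
Qed.
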